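(* Let $\Bbbk$ be a field, let $d\ge 1$ be an integer, let $S=\Bbbk[x,y]$ with the standard grading, and let $B=\bigoplus_{n}S_{nd}$, graded by $B_n=S_{nd}$, be the homogeneous coordinate ring of the rational normal curve of degree $d$. Let $\mathbb{B}_{\mathrm{tot}}(B)\subset\mathbb{Q}^4$ be the cone generated by the vectors $(b_0(M),b_1(M),b_2(M),b_3(M))$ of total Betti numbers of finitely generated graded $B$-modules $M$. Then the closure of $\mathbb{B}_{\mathrm{tot}}(B)$ is $$\Bigl\{(b_0,b_1,b_2,b_3)\in\mathbb{Q}^4 : b_3\ge 0,\ b_2-\tfrac{b_3}{d-1}\ge 0,\ b_1-b_2+\tfrac{b_3}{d}\ge 0,\ b_0-b_1+b_2-\tfrac{b_3}{d}\ge 0\Bigr\},$$ which is a convex polyhedral cone with extremal rays generated by $(1,0,0,0)$, $(1,1,0,0)$, $(0,1,1,0)$ and $(0,1,d,d(d-1))$. The rays generated by $(0,1,1,0)$ and $(0,1,d,d(d-1))$ do not belong to $\mathbb{B}_{\mathrm{tot}}(B)$.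
   Context: For a finitely generated graded $B$-module $M$, the total Betti numbers are $b_i(M)=\dim_\Bbbk\operatorname{Tor}_i^B(\Bbbk,M)$. The cone generated by a set of vectors is the set of their finite nonnegative rational linear combinations. Closure is taken in $\mathbb{Q}^4$ with respect to the usual (Euclidean) topology.
   Formalization: For d = 1 the term b_3/(d-1) is undefined; there the inequality b_2 - b_3/(d-1) ≥ 0 is read as b_3 = 0 and b_2 ≥ 0. For d ≥ 2 the statement is literal. *)

(* Defs.v *)
From HB Require Import structures.
From mathcomp Require Import all_boot all_order all_algebra.
From mathcomp Require Import all_classical topology normedtype.
(* The notations of mpoly clash with those of the analysis library. *)
From mathcomp Require Import -(notations) mpoly.

Set Implicit Arguments.
Unset Strict Implicit.
Unset Printing Implicit Defensive.

Import Order.TTheory GRing.Theory Num.Theory.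

Local Open Scope ring_scope.
Local Open Scope classical_set_scope.

(* The ring B, realized as the subring of S = k[x, y] of the polynomials all of
   whose monomials have total degree divisible by d. *)
Definition veronese_pred (k : fieldType) (d : nat) : {pred mpoly 2 k} :=
  fun p => all (fun m : multinom 2 => (d %| mdeg m)%N) (msupp p).
Arguments veronese_pred : clear implicits.

Lemma veronese_predP (k : fieldType) d (p : mpoly 2 k) :
  reflect (forall m, mcoeff m p != 0 -> (d %| mdeg m)%N)
          (p \in veronese_pred k d).
Proof.
apply: (iffP allP) => h m.
- by rewrite mcoeff_eq0 negbK; apply: h.
- by move=> mp; apply: h; rewrite mcoeff_eq0 negbK.
Qed.

Fact veronese_subring (k : fieldType) d : subring_closed (veronese_pred k d).
Proof.
split.
- apply/veronese_predP => m; rewrite mcoeff1.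
  case: (m =P mnm0) => [-> _|_]; first by rewrite mdeg0 dvdn0.
  by rewrite eqxx.
- move=> p q /veronese_predP hp /veronese_predP hq.
  apply/veronese_predP => m; rewrite mcoeffB => h.
  case: (eqVneq (mcoeff m p) 0) => [p0|]; last exact: hp.
  by apply: hq; apply: contraNneq h => ->; rewrite p0 subr0.
- move=> p q hp hq; apply/allP => m /msuppM_le /allpairsP[[m1 m2] /= [h1 h2 ->]].
  by rewrite mdegD; apply: dvdn_add; [apply: (allP hp)|apply: (allP hq)].
Qed.

HB.instance Definition _ (k : fieldType) d :=
  GRing.isSubringClosed.Build (mpoly 2 k) (veronese_pred k d)
    (veronese_subring k d).

Record veronese (k : fieldType) (d : nat) :=
  Veronese { vval :> mpoly 2 k; _ : vval \in veronese_pred k d }.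
Arguments veronese : clear implicits.

HB.instance Definition _ (k : fieldType) d := [isSub for @vval k d].
HB.instance Definition _ (k : fieldType) d := [Choice of veronese k d by <:].
HB.instance Definition _ (k : fieldType) d :=
  [SubChoice_isSubComNzRing of veronese k d by <:].

(* B_n = S_(nd) *)
Definition veronese_deg (k : fieldType) (d n : nat) : set (veronese k d) :=
  [set b | vval b \is ishomog1 (n * d)%N (@mdeg 2)].
Arguments veronese_deg : clear implicits.

(* The projection B -> B / B_+ = k: the constant coefficient. *)
Definition residue (k : fieldType) (d : nat) : veronese k d -> k :=
  mcoeff (mnm0 : multinom 2) \o @vval k d.

Fact residue_zmod_morphism (k : fieldType) d : zmod_morphism (@residue k d).
Proof. by move=> x y; rewrite /residue /= !raddfB. Qed.

HB.instance Definition _ (k : fieldType) d :=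
  GRing.isZmodMorphism.Build (veronese k d) k (@residue k d)
    (@residue_zmod_morphism k d).

Fact residue_monoid_morphism (k : fieldType) d : monoid_morphism (@residue k d).
Proof.
have [hM h1] := mcoeff0_is_multiplicative 2 k.
by split=> [|x y]; [exact: h1|exact: hM].
Qed.

HB.instance Definition _ (k : fieldType) d :=
  GRing.isMonoidMorphism.Build (veronese k d) k (@residue k d)
    (@residue_monoid_morphism k d).

(* M is the internal direct sum of the subgroups gr n, n in Z, and
   B_i * M_j is contained in M_(i+j). *)
Record is_grading (k : fieldType) (d : nat) (M : lmodType (veronese k d))
    (gr : int -> set M) : Prop := IsGrading {
  gr0 : forall n, gr n 0;
  grB : forall n x y, gr n x -> gr n y -> gr n (x - y);
  grZ : forall (i : nat) (j : int) b x,
    veronese_deg k d i b -> gr j x -> gr (i%:Z + j) (b *: x);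
  gr_span : forall x, exists (s : seq int) (c : int -> M),
    (forall n, gr n (c n)) /\ x = \sum_(n <- s) c n;
  gr_direct : forall (s : seq int) (c : int -> M), uniq s ->
    (forall n, gr n (c n)) -> \sum_(n <- s) c n = 0 ->
    forall n, n \in s -> c n = 0
}.

Definition graded (k : fieldType) (d : nat) (M : lmodType (veronese k d)) :=
  exists gr : int -> set M, is_grading gr.

Definition finitely_generated (R : comNzRingType) (M : lmodType R) :=
  exists (n : nat) (g : 'I_n -> M), forall x,
    exists c : 'I_n -> R, x = \sum_(i < n) c i *: g i.

(* A resolution ... -> R^(rk 1) -> R^(rk 0) -> M -> 0 by free modules of finite
   rank; matrices act on row vectors from the right. *)
Record free_resolution (R : comNzRingType) (M : lmodType R) := FreeResolution {
  rk : nat -> nat;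
  dmx : forall i, 'M[R]_(rk i.+1, rk i);
  aug : {linear 'rV[R]_(rk 0) -> M};
  aug_surj : forall x, exists v, aug v = x;
  aug_exact : forall v, aug v = 0 <-> exists w, v = w *m dmx 0;
  dmx_exact : forall i (v : 'rV[R]_(rk i.+1)),
    v *m dmx i = 0 <-> exists w, v = w *m dmx i.+1
}.

(* dim_k Tor_i^R(k, M), where k is an R-module through e : R -> k, computed on
   a free resolution F of M: k (x) F is the complex of the k^(rk i) with
   differentials map_mx e (dmx i), and its homology at i has dimension
   dim ker - dim im.  The subtraction is exact, since the image lies in the
   kernel. *)
Definition tor_dim (R : comNzRingType) (k : fieldType) (e : {rmorphism R -> k})
    (M : lmodType R) (F : free_resolution M) (i : nat) : nat :=
  match i with
  | 0 => rk F 0 - \rank (map_mx e (dmx F 0))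
  | j.+1 => \rank (kermx (map_mx e (dmx F j)))
            - \rank (map_mx e (dmx F j.+1))
  end.

(* b_i(M) = n for all i; by the independence of Tor from the resolution, such a
   sequence is unique.  Finitely generated modules over the Noetherian ring B
   have resolutions by free modules of finite rank. *)
Definition total_betti (k : fieldType) (d : nat) (M : lmodType (veronese k d))
    (b : nat -> nat) : Prop :=
  exists F : free_resolution M, forall i, b i = tor_dim (@residue k d) F i.

(* The alias rat^o carries the topology given by the absolute value of rat. *)
Notation Q4 := 'rV[rat^o]_4.

Definition vec4 (b0 b1 b2 b3 : rat) : Q4 := \row_i [:: b0; b1; b2; b3]`_i.

Definition cone (X : set Q4) : set Q4 :=
  [set v | exists (n : nat) (c : 'I_n -> rat) (x : 'I_n -> Q4),
     [/\ forall i, 0 <= c i, forall i, X (x i) &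
         v = \sum_(i < n) c i *: x i]].

Definition betti_vectors (k : fieldType) (d : nat) : set Q4 :=
  [set v | exists (M : lmodType (veronese k d)) (b : nat -> nat),
     [/\ graded M, finitely_generated M, total_betti M b &
         v = vec4 (b 0%N)%:R (b 1%N)%:R (b 2%N)%:R (b 3%N)%:R]].

Definition betti_cone (k : fieldType) (d : nat) : set Q4 :=
  cone (betti_vectors k d).

(* For d = 1, where B is a polynomial ring and b3 vanishes on every module,
   b3 / (d - 1) is not defined.  As b3 >= 0, the inequality b3 / (d - 1) <= b2
   is then read with b3 / 0 = +oo for b3 > 0 and 0 / 0 = 0, which is
   (d - 1) * b2 >= b3 together with b2 >= 0. The library convention b3 / 0 = 0
   would make the statement false. *)
Definition second_ineq (d : nat) (b2 b3 : rat) : Prop :=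
  if d == 1%N then b3 = 0 /\ 0 <= b2 else 0 <= b2 - b3 / (d%:R - 1).

Definition betti_polyhedron (d : nat) : set Q4 :=
  [set v | exists b0 b1 b2 b3 : rat,
     v = vec4 b0 b1 b2 b3 /\
     [/\ 0 <= b3,
         second_ineq d b2 b3,
         0 <= b1 - b2 + b3 / d%:R &
         0 <= b0 - b1 + b2 - b3 / d%:R]].

Definition convex_cone (C : set Q4) : Prop :=
  C 0 /\ forall (s t : rat) (x y : Q4),
    0 <= s -> 0 <= t -> C x -> C y -> C (s *: x + t *: y).

(* a finite intersection of closed linear half-spaces *)
Definition polyhedral (C : set Q4) : Prop :=
  exists (n : nat) (A : 'M[rat]_(4, n)),
    C = [set v | forall j, 0 <= (v *m A) 0 j].

Definition ray (v : Q4) : set Q4 :=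
  [set w | exists2 t : rat, 0 <= t & w = t *: v].

Definition extremal_ray (C R : set Q4) : Prop :=
  [/\ exists2 v, v != 0 & R = ray v,
      R `<=` C &
      forall x y, C x -> C y -> R (x + y) -> R x /\ R y].

(* Main.v *)
Require Import Defs.
From HB Require Import structures.
From mathcomp Require Import all_boot all_order all_algebra.
From mathcomp Require Import all_classical topology normedtype.
From mathcomp Require Import -(notations) mpoly.
From mathcomp Require Import zify ring lra.

(** Write u = x^d, v = y^d and A = k[u, v]. Everything rests on two facts about
    the ring B: it is free of rank d over A, with basis 1 and the monomials
    x^j y^(d-j) for 0 < j < d (basis_free, basis_span), and the special fibre
    B/(u, v)B is k + V with V^2 = 0 and dim V = d - 1 (fibre_coeffM).

    The inequalities. Let F be a resolution of M by free B-modules of finite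
    rank, which need neither be graded nor minimal. Viewed over A it is a
    complex of free A-modules, exact in positive degrees. Let sigma_i, tau_i and
    rho_i be the ranks of its i-th differential F_(i+1) -> F_i over k = B/B_+,
    over A/(u, v) = k (after restriction to A), and over the fraction field of A.
    A chase with the regular sequence u, v shows that the complex stays exact
    modulo (u, v) in degree 3 (exact_mod_reg; this is Tor_3 (A/(u, v), M) = 0).
    As tau_i <= rho_i (mxrank_specialize), and as ranks of consecutive maps add
    up at an exact spot, it follows that tau_2 = rho_2. Because V^2 = 0, the
    number tau_2 can be computed from the sigma_i (dim_limg_sqz_exact), which
    gives
      b_3 = rho_2 - d sigma_2,
      d (b_0 - b_1 + b_2) - b_3 = d rk F_0 - rho_0,
      d (b_1 - b_2) + b_3 = rho_0 - d sigma_0;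
    the last two are nonnegative because d sigma_0 <= tau_0 <= rho_0
    (dim_limg_sqz_map_ge) and rho_0 <= d rk F_0. The same structure embeds
    Tor_3 (k, M) into V (x) Tor_2 (k, M), so that b_3 <= (d-1) b_2
    (homology_growth).

    The modules. The four rays are approximated by B, whose vector is (1, 0, 0, 0),
    and by the cyclic modules B/I, where I is generated by the elements
    x^d s^(m-i) t^i for i <= m, with (s, t) = (u, v) or (s, t) = (x, y). Over
    k[x, y] the Hilbert-Burch theorem describes the relations between these
    generators. Over B the first choice gives the numbers (1, m+1, m, 0), and
    the second, for d | m, gives (1, m+1, m d, m d (d-1)), since the relations
    between the generators of I are then m copies of the B-module of polynomials
    whose monomials have degree -1 modulo d, and the relations between the d
    generators of that module are d-1 copies of itself (hb_dmx_exact). After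
    division by m the vectors tend to (0, 1, 1, 0) and (0, 1, d, d(d-1)), and the error
    is a multiple of (1, 1, 0, 0), which is itself the case m = 0.

    The two missing rays. A point of the cone with b_0 = 0 is a combination of
    vectors of modules with M = B_+ M. These modules vanish by the graded
    Nakayama lemma, and then all their Betti numbers vanish
    (total_betti_zero). *)

Set Implicit Arguments.
Unset Strict Implicit.
Unset Printing Implicit Defensive.

Import Order.TTheory GRing.Theory Num.Theory.
Local Open Scope ring_scope.

(** * Ranks over a domain, its fraction field and a residue field *)

Section Specialization.
Variables (A : idomainType) (k : fieldType) (e : {rmorphism A -> k}).
Variables (s : k -> A) (sK : cancel s e).
Local Notation fr := (@FracField.tofrac A).

(** A minor that is nonzero after specialization was nonzero before; the minor
    is replaced by the compression of P to a square matrix that specializes to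
    the identity. *)
Lemma mxrank_specialize m n (P : 'M[A]_(m, n)) :
  (\rank (map_mx e P) <= \rank (map_mx fr P))%N.
Proof.
set M := map_mx e P; set r := \rank M.
have [L LM] : exists L : 'M[k]_(r, m), L *m col_base M = 1%:M.
  apply/row_fullP; exact: col_base_full.
have [N NM] : exists N : 'M[k]_(n, r), row_base M *m N = 1%:M.
  apply/row_freeP; exact: row_base_free.
have LMN : L *m M *m N = 1%:M.
  by rewrite -{1}(mulmx_base M) mulmxA LM mul1mx NM.
pose Q : 'M[A]_r := map_mx s L *m P *m map_mx s N.
have eQ : map_mx e Q = 1%:M.
  rewrite !map_mxM /= -LMN; congr (_ *m _ *m _).
    by apply/matrixP=> i j; rewrite !mxE sK.
  by apply/matrixP=> i j; rewrite !mxE sK.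
have dQ : \det Q != 0.
  apply: contraTneq isT => d0.
  by have := det_map_mx e Q; rewrite eQ det1 d0 rmorph0 => /eqP; rewrite oner_eq0.
have uQ : map_mx fr Q \in unitmx.
  by rewrite unitmxE det_map_mx unitfE tofrac_eq0.
rewrite -(mxrank_unit uQ) !map_mxM.
exact: leq_trans (mxrankM_maxl _ _) (mxrankM_maxr _ _).
Qed.

End Specialization.

Lemma mxrank_exact_field (F : fieldType) m n p (P : 'M[F]_(m, n))
    (Q : 'M[F]_(n, p)) :
  (forall v : 'rV_n, v *m Q = 0 <-> exists w, v = w *m P) ->
  (\rank P + \rank Q = n)%N.
Proof.
move=> ex; suff eqPQ : (P == kermx Q)%MS.
  by rewrite (eqmx_rank eqPQ) mxrank_ker subnK // rank_leq_row.
apply/andP; split; apply/row_subP => i.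
  by apply/sub_kermxP/ex; exists (delta_mx 0 i); rewrite -rowE.
have /sub_kermxP/ex[w ->] : (row i (kermx Q) <= kermx Q)%MS by exact: row_sub.
exact: submxMl.
Qed.

Section FractionRank.
Variable A : idomainType.
Local Notation fr := (@FracField.tofrac A).

Lemma fraction_denom (z : {fraction A}) :
  exists p : A * A, p.2 != 0 /\ fr p.2 * z = fr p.1.
Proof.
elim/quotW: z => z; exists (\n_z, \d_z)%R; split; first exact: denom_ratioP.
rewrite /=; unlock FracField.tofrac; rewrite -[LHS]FracField.pi_mul.
apply/eqmodP => /=; rewrite FracField.equivfE /FracField.mulf.
by rewrite !numden_Ratio ?mul1r ?mulr1 ?oner_neq0 ?denom_ratioP // mulrC.
Qed.

Lemma fraction_common_denom n (x : 'rV[{fraction A}]_n) :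
  exists2 a : A, a != 0 & exists y : 'rV[A]_n, fr a *: x = map_mx fr y.
Proof.
have /fin_all_exists[p pP] := fun j => fraction_denom (x 0 j).
exists (\prod_j (p j).2).
  by apply/prodf_neq0 => j _; case: (pP j).
exists (\row_j ((\prod_(i | i != j) (p i).2) * (p j).1)).
apply/rowP => j; rewrite !mxE (bigD1 j) //= !rmorphM /= mulrAC mulrC.
by rewrite -[RHS]mulrC; case: (pP j) => _ <-; rewrite mulrC.
Qed.

(** Passing to fractions is exact: a kernel vector becomes integral after
    multiplication by a common denominator. *)
Lemma mxrank_exact m n p (P : 'M[A]_(m, n)) (Q : 'M[A]_(n, p)) :
  (forall v : 'rV_n, v *m Q = 0 <-> exists w, v = w *m P) ->
  (\rank (map_mx fr P) + \rank (map_mx fr Q) = n)%N.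
Proof.
move=> ex; apply: mxrank_exact_field => x.
have frI q : injective (map_mx fr : 'rV_q -> 'rV_q).
  move=> a b /rowP ab; apply/rowP => j; have := ab j.
  by rewrite !mxE => /eqP; rewrite tofrac_eq => /eqP.
split=> [xQ|[w ->]]; last first.
  have PQ : P *m Q = 0.
    apply/row_matrixP => i; rewrite row0 row_mul.
    by apply/ex; exists (delta_mx 0 i); rewrite -rowE.
  by rewrite -mulmxA -map_mxM PQ map_mx0 mulmx0.
have [a a0 [y xy]] := fraction_common_denom x.
have /ex[w yw] : y *m Q = 0.
  by apply: frI; rewrite map_mxM -xy -scalemxAl xQ scaler0 map_mx0.
exists ((fr a)^-1 *: map_mx fr w).
by rewrite -scalemxAl -map_mxM -yw -xy scalerA mulVf ?tofrac_eq0 // scale1r.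
Qed.

End FractionRank.

(** * Exactness modulo a regular sequence *)

Section RegularSequence.
Variables (A : idomainType) (k : fieldType) (e : {rmorphism A -> k}).
Variables (s : k -> A) (sK : cancel s e) (u v : A).
Hypothesis v0 : v != 0.
Hypothesis reg : forall a b, u * a + v * b = 0 ->
  exists c, a = v * c /\ b = - (u * c).
Hypothesis eu : e u = 0.
Hypothesis ev : e v = 0.
Hypothesis ker_e : forall a, e a = 0 -> exists b c, a = u * b + v * c.

Lemma ker_e_row n (a : 'rV[A]_n) : map_mx e a = 0 ->
  exists b c, a = u *: b + v *: c.
Proof.
move=> ea.
have /fin_all_exists[p pP] : forall j, exists p : A * A, a 0 j = u * p.1 + v * p.2.
  move=> j; have /ker_e[b [c bc]] : e (a 0 j) = 0.
    by have /rowP/(_ j) := ea; rewrite !mxE.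
  by exists (b, c).
exists (\row_j (p j).1), (\row_j (p j).2).
by apply/rowP => j; rewrite !mxE pP.
Qed.

Lemma reg_row n (a b : 'rV[A]_n) : u *: a + v *: b = 0 ->
  exists c, a = v *: c /\ b = - (u *: c).
Proof.
move=> /rowP ab.
have /fin_all_exists[c cP] : forall j, exists c,
    a 0 j = v * c /\ b 0 j = - (u * c).
  by move=> j; apply: reg; have := ab j; rewrite !mxE.
exists (\row_j c j); split; apply/rowP => j; rewrite !mxE; by case: (cP j).
Qed.

(** If d z = u a + v b, then (d a, d b) = (v c, - u c) for a cycle c, because u, v
    is regular; c bounds some f, and correcting a and b by multiples of f makes
    them cycles, hence boundaries of g and h. Then z - u g - v h is a cycle.
    Exactness is used at three consecutive spots. *)
Lemma exact_mod_reg n0 n1 n2 n3 n4 (E0 : 'M[A]_(n1, n0)) (E1 : 'M[A]_(n2, n1))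
    (E2 : 'M[A]_(n3, n2)) (E3 : 'M[A]_(n4, n3)) :
  (forall w : 'rV_n1, w *m E0 = 0 <-> exists x, w = x *m E1) ->
  (forall w : 'rV_n2, w *m E1 = 0 <-> exists x, w = x *m E2) ->
  (forall w : 'rV_n3, w *m E2 = 0 <-> exists x, w = x *m E3) ->
  forall z : 'rV[k]_n3,
    z *m map_mx e E2 = 0 <-> exists x, z = x *m map_mx e E3.
Proof.
move=> ex0 ex1 ex2 z.
have lift n (y : 'rV[k]_n) : map_mx e (map_mx s y) = y.
  by apply/rowP => j; rewrite !mxE sK.
have vI n (x y : 'rV[A]_n) : v *: x = v *: y -> x = y.
  move=> /rowP xy; apply/rowP => j; have := xy j.
  by rewrite !mxE => /(mulfI v0).
have evan n (x y : 'rV[A]_n) : map_mx e (u *: x + v *: y) = 0.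
  by rewrite map_mxD !map_mxZ /= eu ev !scale0r addr0.
split=> [zE|[x ->]]; last first.
  rewrite -[x]lift -!map_mxM.
  have /ex2 -> : exists y, map_mx s x *m E3 = y *m E3 by eexists.
  exact: map_mx0.
have /ker_e_row[a [b ab]] : map_mx e (map_mx s z *m E2) = 0.
  by rewrite map_mxM lift.
have E21 : map_mx s z *m E2 *m E1 = 0 by apply/ex1; eexists.
have /reg_row[c [ac bc]] : u *: (a *m E1) + v *: (b *m E1) = 0.
  by rewrite -[RHS]E21 ab mulmxDl -!scalemxAl.
have /ex0[f fc] : c *m E0 = 0.
  apply: vI; rewrite scaler0 scalemxAl -ac.
  by apply/ex0; eexists.
have /ex1[g ga] : (a - v *: f) *m E1 = 0.
  by rewrite mulmxBl -scalemxAl -fc ac subrr.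
have /ex1[h hb] : (b + u *: f) *m E1 = 0.
  by rewrite mulmxDl -scalemxAl -fc bc addNr.
have /ex2[x xz] : (map_mx s z - (u *: g + v *: h)) *m E2 = 0.
  rewrite mulmxBl mulmxDl ab -!scalemxAl -ga -hb !scalerBr !scalerDr !scalerA.
  by rewrite [v * u]mulrC addrA addrAC subrK subrr.
by exists (map_mx e x); rewrite -map_mxM -xz map_mxB lift evan subr0.
Qed.

End RegularSequence.

(** * Linear algebra over the square-zero extension *)

Section LinearMaps.
Variable k : fieldType.

(** The image of right multiplication by D is that of the injective right
    multiplication by a row basis of D. *)
Lemma dim_limg_mulmxr m n q (D : 'M[k]_(n, q)) :
  \dim (limg (linfun (mulmxr D : 'M[k]_(m, n) -> 'M_(m, q)))) = (m * \rank D)%N.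
Proof.
set f := linfun _; pose g := linfun (mulmxr (row_base D) : 'M_(m, _) -> 'M_(m, q)).
have -> : limg f = limg g.
  apply/eqP; rewrite eqEsubv; apply/andP; split; apply/subvP => _ /memv_imgP[x _ ->].
    rewrite lfunE /= -{1}(mulmx_base D) mulmxA.
    have -> : x *m col_base D *m row_base D = g (x *m col_base D) by rewrite lfunE.
    by rewrite memv_img ?memvf.
  have [y Dy] : exists y, row_base D = y *m D by apply/submxP; rewrite eq_row_base.
  rewrite lfunE /= Dy mulmxA.
  have -> : x *m y *m D = f (x *m y) by rewrite lfunE.
  by rewrite memv_img ?memvf.
rewrite limg_dim_eq ?dimvf ?dim_matrix //.
apply/eqP; rewrite capfv; apply/lker0P => x y; rewrite !lfunE /=.
exact: (row_free_inj (row_base_free D)).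
Qed.

Lemma dim_lker_mulmxr m n q (D : 'M[k]_(n, q)) :
  \dim (lker (linfun (mulmxr D : 'M[k]_(m, n) -> 'M_(m, q)))) =
  (m * (n - \rank D))%N.
Proof.
have := limg_ker_dim (linfun (mulmxr D : 'M[k]_(m, n) -> 'M_(m, q))) fullv.
rewrite capfv dim_limg_mulmxr dimvf dim_matrix mulnBr => mn.
by rewrite -(addnK (m * \rank D) (\dim _)) mn.
Qed.

Lemma rank_lin_mx m1 n1 m2 n2 (f : {linear 'M[k]_(m1, n1) -> 'M[k]_(m2, n2)}) :
  \rank (lin_mx f) = \dim (limg (linfun f)).
Proof.
rewrite -[LHS]mul1n -dim_limg_mulmxr.
have mI : lker (linfun (@mxvec k m2 n2)) == 0%VS.
  by apply/lker0P => x y; rewrite !lfunE; apply: (can_inj mxvecK).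
rewrite -(limg_dim_eq (f := linfun (@mxvec k m2 n2))); last first.
  by rewrite (eqP mI) capv0.
congr (\dim _); apply/eqP; rewrite eqEsubv; apply/andP; split; apply/subvP.
  move=> _ /memv_imgP[x _ ->]; rewrite lfunE /= mul_rV_lin.
  have -> : mxvec (f (vec_mx x)) = linfun (@mxvec k m2 n2) (linfun f (vec_mx x)).
    by rewrite !lfunE.
  by rewrite !memv_img ?memvf.
move=> _ /memv_imgP[_ /memv_imgP[x _ ->] ->]; rewrite !lfunE /= -mul_vec_lin.
have -> : mxvec x *m lin_mx f = linfun (mulmxr (lin_mx f)) (mxvec x) by rewrite lfunE.
by rewrite memv_img ?memvf.
Qed.

End LinearMaps.

Section SquareZero.
Variables (k : fieldType) (p : nat).

(** Let V be spanned by v_1, ..., v_p with all products zero. A matrix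
    D + sum_j v_j C_j over k + V acts on vectors x + sum_j v_j y_j; the row x and
    the rows y_j are stacked in X, and c maps x to the stack of the rows
    x C_j. *)
Definition sqz_map n q (D : 'M[k]_(n, q)) (c : 'rV[k]_n -> 'M[k]_(p, q))
    (X : 'M[k]_(1 + p, n)) : 'M[k]_(1 + p, q) :=
  X *m D + col_mx 0 (c (usubmx X)).

(** The inclusion of the part with coefficients in V. *)
Definition bot_mx n : 'M[k]_(p, n) -> 'M[k]_(1 + p, n) := col_mx 0.

Fact bot_mx_is_linear n : linear (@bot_mx n).
Proof. by move=> a X Y; rewrite /bot_mx scale_col_mx add_col_mx scaler0 addr0. Qed.

HB.instance Definition _ n :=
  GRing.isLinear.Build k _ _ _ (@bot_mx n) (@bot_mx_is_linear n).

Section OneMap.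
Variables (n q : nat) (D : 'M[k]_(n, q)) (c : {linear 'rV[k]_n -> 'M[k]_(p, q)}).

Lemma sqz_map_is_linear : linear (sqz_map D c).
Proof.
move=> a X Y; rewrite /sqz_map mulmxDl -scalemxAl scalerDr addrACA; congr (_ + _).
by rewrite !linearP /= scale_col_mx add_col_mx scaler0 addr0.
Qed.

HB.instance Definition _ :=
  GRing.isLinear.Build k 'M[k]_(1 + p, n) 'M[k]_(1 + p, q) _ (sqz_map D c)
    sqz_map_is_linear.

Local Notation g := (linfun (sqz_map D c)).
Local Notation top := (linfun (@usubmx k 1 p n)).

Lemma sqz_map_col x Y : sqz_map D c (col_mx x Y) = col_mx (x *m D) (Y *m D + c x).
Proof. by rewrite /sqz_map mul_col_mx add_col_mx addr0 col_mxKu. Qed.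

(** The elements of the kernel with zero top row are p independent copies of
    the kernel of D. *)
Lemma dim_lker_sqz_map :
  \dim (lker g) = (\dim (top @: lker g) + p * (n - \rank D))%N.
Proof.
rewrite -(limg_ker_dim top (lker g)) addnC; congr (_ + _)%N.
rewrite -dim_lker_mulmxr.
have bI : lker (linfun (@bot_mx n)) == 0%VS.
  by apply/lker0P => x y; rewrite !lfunE => /eq_col_mx[].
rewrite -[RHS](limg_dim_eq (f := linfun (@bot_mx n))); last first.
  by rewrite (eqP bI) capv0.
congr (\dim _); apply/eqP; rewrite eqEsubv; apply/andP; split; apply/subvP => X.
  rewrite memv_cap !memv_ker !lfunE /= => /andP[gX /eqP X0].
  have XE : X = linfun (@bot_mx n) (dsubmx X) by rewrite lfunE -{1}(vsubmxK X) X0.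
  rewrite XE memv_img //; move: gX; rewrite memv_ker lfunE /=.
  rewrite -{1}(vsubmxK X) X0 sqz_map_col mul0mx linear0 addr0.
  by rewrite -col_mx0 => /eqP/eq_col_mx[_ ->].
case/memv_imgP => Y; rewrite memv_ker lfunE /= => /eqP Y0 ->.
rewrite memv_cap !memv_ker !lfunE /= sqz_map_col Y0 mul0mx linear0 addr0.
by rewrite col_mx0 eqxx col_mxKu /=.
Qed.

Lemma dim_limg_sqz_map : (\dim (lker g) + \dim (limg g) = p.+1 * n)%N.
Proof. by have := limg_ker_dim g fullv; rewrite capfv dimvf dim_matrix. Qed.

(** D and p copies of it contribute their ranks independently. *)
Lemma dim_limg_sqz_map_ge : (p.+1 * \rank D <= \dim (limg g))%N.
Proof.
have topS : (top @: lker g <= lker (linfun (mulmxr D : 'rV_n -> 'rV_q)))%VS.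
  apply/subvP => _ /memv_imgP[X + ->]; rewrite !memv_ker !lfunE /= => /eqP gX.
  move: gX; rewrite -{1}(vsubmxK X) sqz_map_col -col_mx0 => /eq_col_mx[-> _].
  by rewrite eqxx.
have := dim_lker_sqz_map; have := dim_limg_sqz_map.
have := dimvS topS; rewrite dim_lker_mulmxr.
have := rank_leq_row D; move: (\rank D) (\dim _) (\dim (lker _)) (\dim _); nia.
Qed.

End OneMap.

Section ThreeMaps.
Variables (n1 n2 n3 n4 : nat).
Variables (D1 : 'M[k]_(n2, n1)) (D2 : 'M[k]_(n3, n2)) (D3 : 'M[k]_(n4, n3)).
Variables (c1 : {linear 'rV[k]_n2 -> 'M[k]_(p, n1)}).
Variables (c2 : {linear 'rV[k]_n3 -> 'M[k]_(p, n2)}).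
Variables (c3 : {linear 'rV[k]_n4 -> 'M[k]_(p, n3)}).
Hypothesis g12 : forall X, sqz_map D1 c1 (sqz_map D2 c2 X) = 0.
Hypothesis ex23 : forall X,
  sqz_map D2 c2 X = 0 <-> exists Y, X = sqz_map D3 c3 Y.

Local Notation g2 := (linfun (sqz_map D2 c2)).
Local Notation top := (linfun (@usubmx k 1 p n3)).

(** By exactness the kernel of the middle map is the image of the map before
    it, whose top rows form the image of D3. *)
Lemma dim_top_lker : \dim (top @: lker g2) = \rank D3.
Proof.
rewrite -[RHS]mul1n -dim_limg_mulmxr; congr (\dim _).
apply/eqP; rewrite eqEsubv; apply/andP; split; apply/subvP.
  move=> _ /memv_imgP[X + ->]; rewrite memv_ker !lfunE => /eqP/ex23[Y ->].
  rewrite /= -(vsubmxK Y) sqz_map_col col_mxKu.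
  have -> : usubmx Y *m D3 = linfun (mulmxr D3) (usubmx Y) by rewrite lfunE.
  by rewrite memv_img ?memvf.
move=> _ /memv_imgP[x _ ->].
have -> : linfun (mulmxr D3) x = top (sqz_map D3 c3 (col_mx x 0)).
  by rewrite !lfunE /= sqz_map_col col_mxKu.
by apply: memv_img; rewrite memv_ker lfunE; apply/eqP/ex23; eexists.
Qed.

Lemma dim_limg_sqz_exact :
  (\dim (limg g2) + \rank D3 = n3 + p * \rank D2)%N.
Proof.
have := dim_limg_sqz_map D2 c2; rewrite dim_lker_sqz_map dim_top_lker.
have := rank_leq_row D2; move: (\rank D2) (\rank D3) (\dim _); nia.
Qed.

(** In terms of h_i = dim ker D_(i-1) - rank D_i this says h_3 <= p h_2: a cycle x
    of D2 is sent by c2 to a p-tuple of cycles of D1, and it is a boundary of D3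
    as soon as that tuple consists of boundaries of D2. The proof counts the
    dimension of the space of all X whose top row is such a cycle. *)
Lemma homology_growth :
  (n3 + p * (\rank D1 + \rank D2) <= \rank D2 + \rank D3 + p * n2)%N.
Proof.
pose h := linfun (mulmxr D2 \o @usubmx k 1 p n3).
have hS : (limg h <= limg (linfun (mulmxr D2 : 'rV_n3 -> 'rV_n2)))%VS.
  apply/subvP => _ /memv_imgP[X _ ->].
  have -> : h X = linfun (mulmxr D2) (usubmx X) by rewrite !lfunE.
  by rewrite memv_img ?memvf.
have gS : (g2 @: lker h <=
    linfun (@bot_mx n2) @: lker (linfun (mulmxr D1 : 'M_(p, _) -> 'M_(p, _))))%VS.
  apply/subvP => _ /memv_imgP[X + ->]; rewrite memv_ker !lfunE /= => /eqP X0.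
  have XE : sqz_map D2 c2 X = col_mx 0 (dsubmx X *m D2 + c2 (usubmx X)).
    by rewrite -{1}(vsubmxK X) sqz_map_col X0.
  rewrite XE; set Y := _ + _.
  have -> : col_mx 0 Y = linfun (@bot_mx n2) Y by rewrite lfunE.
  rewrite memv_img // memv_ker lfunE /=.
  have := g12 X; rewrite XE sqz_map_col linear0 addr0 -col_mx0.
  by case/eq_col_mx => _ ->.
have := dimvS hS; have := dimvS gS; rewrite dim_limg_mulmxr.
have := dim_lker_sqz_map D2 c2; rewrite dim_top_lker.
have := limg_ker_dim h fullv; rewrite capfv dimvf dim_matrix.
have := limg_ker_dim g2 (lker h).
have := dimvS (capvSr (lker h) (lker g2)).
have := limg_ker_dim (linfun (@bot_mx n2))
  (lker (linfun (mulmxr D1 : 'M_(p, _) -> 'M_(p, _)))).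
rewrite dim_lker_mulmxr.
have := rank_leq_row D2; have := rank_leq_row D1.
move: (\rank D1) (\rank D2) (\rank D3) (\dim _) (\dim (lker g2)) (\dim (lker h))
  (\dim (_ @: _)) (\dim (_ @: _)) (\dim (_ :&: _)) (\dim (limg h)).
nia.
Qed.

End ThreeMaps.
End SquareZero.

(** * Betti numbers over a free extension with square-zero special fibre *)

Section FreeExtension.
(* R is free over A on the basis beta, with coordinates coord. The maps res and
   kap give the coordinates in the fibre R / (u, v) R = k + V, and kapM says that
   V has square zero. *)
Variables (A : idomainType) (k : fieldType) (R : comNzRingType) (p : nat).
Variables (e : {rmorphism A -> k}) (s : k -> A) (sK : cancel s e) (u v : A).
Hypothesis v0 : v != 0.
Hypothesis reg : forall a b, u * a + v * b = 0 ->
  exists c, a = v * c /\ b = - (u * c).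
Hypothesis eu : e u = 0.
Hypothesis ev : e v = 0.
Hypothesis ker_e : forall a, e a = 0 -> exists b c, a = u * b + v * c.

Variables (iota : {rmorphism A -> R}) (beta : 'I_(1 + p) -> R).
Variable coord : R -> 'I_(1 + p) -> A.
Hypothesis coordK : forall r, \sum_l iota (coord r l) * beta l = r.
Hypothesis beta_free : forall a : 'I_(1 + p) -> A,
  \sum_l iota (a l) * beta l = 0 -> forall l, a l = 0.

Variables (res : {rmorphism R -> k}) (kap : 'I_p -> {additive R -> k}).
Hypothesis res_beta : forall a : 'I_(1 + p) -> A,
  res (\sum_l iota (a l) * beta l) = e (a (lshift p 0)).
Hypothesis kap_beta : forall j (a : 'I_(1 + p) -> A),
  kap j (\sum_l iota (a l) * beta l) = e (a (rshift 1 j)).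
Hypothesis kapM : forall j x y, kap j (x * y) = res x * kap j y + kap j x * res y.

Definition assemble n (X : 'M[A]_(1 + p, n)) : 'rV[R]_n :=
  \row_a \sum_l iota (X l a) * beta l.

Definition expand n (w : 'rV[R]_n) : 'M[A]_(1 + p, n) :=
  \matrix_(l, a) coord (w 0 a) l.

Lemma expandK n : cancel (@expand n) (@assemble n).
Proof.
move=> w; apply/rowP => a; rewrite !mxE -[RHS]coordK.
by apply: eq_bigr => l _; rewrite !mxE.
Qed.

Lemma assemble_is_additive n : zmod_morphism (@assemble n).
Proof.
move=> X Y; apply/rowP => a; rewrite !mxE -sumrB; apply: eq_bigr => l _.
by rewrite !mxE rmorphB mulrBl.
Qed.

HB.instance Definition _ n :=
  GRing.isZmodMorphism.Build _ _ (@assemble n) (@assemble_is_additive n).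

Lemma assembleZ n a (X : 'M[A]_(1 + p, n)) :
  assemble (a *: X) = iota a *: assemble X.
Proof.
apply/rowP => b; rewrite !mxE mulr_sumr; apply: eq_bigr => l _.
by rewrite !mxE rmorphM mulrA.
Qed.

Lemma assemble_inj n : injective (@assemble n).
Proof.
move=> X Y /eqP; rewrite -subr_eq0 -raddfB => /eqP/rowP XY.
apply/eqP; rewrite -subr_eq0; apply/eqP/matrixP => l a.
have := XY a; rewrite !mxE => /beta_free/(_ l) <-.
by rewrite !mxE.
Qed.

Lemma assembleK n : cancel (@assemble n) (@expand n).
Proof. by move=> X; apply: assemble_inj; rewrite expandK. Qed.

(** The A-linear map that D induces on coordinates. *)
Definition restrict n q (D : 'M[R]_(n, q)) (X : 'M[A]_(1 + p, n)) :
  'M[A]_(1 + p, q) := expand (assemble X *m D).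

Lemma assemble_restrict n q (D : 'M[R]_(n, q)) X :
  assemble (restrict D X) = assemble X *m D.
Proof. exact: expandK. Qed.

Lemma restrict_is_linear n q (D : 'M[R]_(n, q)) : linear (restrict D).
Proof.
move=> a X Y; apply: assemble_inj.
rewrite /restrict expandK [assemble (_ + _)]raddfD /= assembleZ mulmxDl.
by rewrite [RHS]raddfD /= assembleZ !expandK scalemxAl.
Qed.

HB.instance Definition _ n q (D : 'M[R]_(n, q)) :=
  GRing.isLinear.Build A _ _ _ (restrict D) (restrict_is_linear D).

Lemma restrict_exact n q m (P : 'M[R]_(m, n)) (D : 'M[R]_(n, q)) :
  (forall w : 'rV_n, w *m D = 0 <-> exists x, w = x *m P) ->
  forall w : 'rV_((1 + p) * n),
    w *m lin_mx (restrict D) = 0 <-> exists x, w = x *m lin_mx (restrict P).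
Proof.
move=> ex w; split=> [|[x ->]]; rewrite !mul_rV_lin.
  move=> /eqP; rewrite mxvec_eq0 => /eqP/(congr1 (@assemble _)).
  rewrite assemble_restrict raddf0 => /ex[x wx]; exists (mxvec (expand x)).
  by rewrite mul_vec_lin /= /restrict expandK -wx assembleK vec_mxK.
apply/eqP; rewrite mxvec_eq0 mxvecK; apply/eqP/assemble_inj.
by rewrite !assemble_restrict raddf0; apply/ex; eexists.
Qed.

Definition fibre n q (D : 'M[R]_(n, q)) (x : 'rV[k]_n) : 'M[k]_(p, q) :=
  \matrix_j (x *m map_mx (kap j) D).

Lemma fibre_is_linear n q (D : 'M[R]_(n, q)) : linear (fibre D).
Proof.
move=> a x y; apply/row_matrixP => j; rewrite !linearP /= !rowK mulmxDl.
by rewrite scalemxAl.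
Qed.

HB.instance Definition _ n q (D : 'M[R]_(n, q)) :=
  GRing.isLinear.Build k _ _ _ (fibre D) (fibre_is_linear D).

Lemma res_assemble n (X : 'M[A]_(1 + p, n)) :
  map_mx res (assemble X) = map_mx e (usubmx X).
Proof. by apply/rowP => a; rewrite !mxE res_beta. Qed.

Lemma kap_assemble n j (X : 'M[A]_(1 + p, n)) :
  map_mx (kap j) (assemble X) = map_mx e (row j (dsubmx X)).
Proof. by apply/rowP => a; rewrite !mxE kap_beta. Qed.

(** Modulo (u, v) the restricted map is the action of a matrix over the
    square-zero fibre. *)
Lemma restrict_mod n q (D : 'M[R]_(n, q)) (X : 'M[A]_(1 + p, n)) :
  map_mx e (restrict D X) = sqz_map (map_mx res D) (fibre D) (map_mx e X).
Proof.
set Y := restrict D X; have YE := assemble_restrict D X : assemble Y = _.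
rewrite -(vsubmxK (map_mx e Y)) -[map_mx e X]vsubmxK sqz_map_col.
rewrite -!map_usubmx -!map_dsubmx -!res_assemble YE map_mxM; congr col_mx.
apply/row_matrixP => j; rewrite -map_row -kap_assemble YE raddfD /= row_mul.
rewrite -map_row -kap_assemble rowK.
apply/rowP => b; rewrite !mxE raddf_sum -big_split /=; apply: eq_bigr => a _.
by rewrite kapM !mxE addrC.
Qed.

Variables (M : lmodType R) (F : free_resolution M).
Local Notation r i := (rk F i).
Local Notation E i := (lin_mx (restrict (dmx F i))).
Local Notation rho i := (\rank (map_mx (@FracField.tofrac A) (E i))).
Local Notation tau i := (\rank (map_mx e (E i))).
Local Notation sigma i := (\rank (map_mx res (dmx F i))).
Local Notation sq i := (sqz_map (map_mx res (dmx F i)) (fibre (dmx F i))).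

Let E_exact i (w : 'rV_((1 + p) * r i.+1)) :
  w *m E i = 0 <-> exists x, w = x *m E i.+1.
Proof. by apply: restrict_exact; exact: dmx_exact. Qed.

Let mapE i : map_mx e (E i) = lin_mx (sq i).
Proof. by apply: map_lin_mx => X; rewrite restrict_mod. Qed.

Let tauE i : tau i = \dim (limg (linfun (sq i))).
Proof. by rewrite mapE rank_lin_mx. Qed.

Let E_mod_exact (w : 'rV[k]_((1 + p) * r 3)) :
  w *m map_mx e (E 2) = 0 <-> exists x, w = x *m map_mx e (E 3).
Proof.
exact: (exact_mod_reg sK v0 reg eu ev ker_e (@E_exact 0) (@E_exact 1) (@E_exact 2)).
Qed.

Let rhoD i : (rho i + rho i.+1 = p.+1 * r i.+1)%N.
Proof. by rewrite addnC; apply: mxrank_exact; exact: E_exact. Qed.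

Let tau_rho i : (tau i <= rho i)%N.
Proof. exact: (mxrank_specialize sK). Qed.

(* tau 2 + tau 3 and rho 2 + rho 3 are both the rank of the third module, while
   tau i <= rho i. *)
Let tau2 : tau 2 = rho 2.
Proof.
have := mxrank_exact_field E_mod_exact; have := rhoD 2.
have := tau_rho 2; have := tau_rho 3; lia.
Qed.

Let sq_exact X : sq 2 X = 0 <-> exists Y, X = sq 3 Y.
Proof.
have := E_mod_exact (mxvec X); rewrite !mapE mul_vec_lin => ex; split.
  move=> X0; have /ex[y] : mxvec (sq 2 X) = 0 by rewrite X0 linear0.
  rewrite mul_rV_lin => /(can_inj mxvecK) ->; by eexists.
move=> [Y XY]; apply: (can_inj mxvecK); rewrite linear0; apply/ex.
by exists (mxvec Y); rewrite mul_vec_lin XY.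
Qed.

Lemma dmx_complex i : dmx F i.+1 *m dmx F i = 0.
Proof.
apply/row_matrixP => j; rewrite row0 row_mul.
by apply/dmx_exact; exists (delta_mx 0 j); rewrite -rowE.
Qed.

Let sq_complex X : sq 1 (sq 2 X) = 0.
Proof.
have [Y ->] : exists Y : 'M[A]_(1 + p, r 3), X = map_mx e Y.
  by exists (map_mx s X); apply/matrixP => i j; rewrite !mxE sK.
rewrite -!restrict_mod /restrict expandK -mulmxA dmx_complex mulmx0.
have -> : expand (0 : 'rV[R]_(r 1)) = 0 by apply: assemble_inj; rewrite expandK raddf0.
exact: map_mx0.
Qed.

Let sigma_complex i : (sigma i + sigma i.+1 <= r i.+1)%N.
Proof.
have /sub_kermxP/mxrankS : map_mx res (dmx F i.+1) *m map_mx res (dmx F i) = 0.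
  by rewrite -map_mxM dmx_complex map_mx0.
rewrite mxrank_ker; have := rank_leq_row (map_mx res (dmx F i)); lia.
Qed.

Lemma tor_dim0E : tor_dim res F 0 = (r 0 - sigma 0)%N. Proof. by []. Qed.

Lemma tor_dimSE i : tor_dim res F i.+1 = (r i.+1 - sigma i - sigma i.+1)%N.
Proof. by rewrite /= mxrank_ker. Qed.

(** With rho 0 + rho 1 and rho 1 + rho 2 known from exactness, rho 2 is determined
    by rho 0, and p.+1 * sigma 0 <= tau 0 <= rho 0 <= p.+1 * rk F 0. Since
    tau 2 = rho 2, expressing tau 2 through the sigma i gives the last two
    inequalities; the first one is homology_growth. *)
Theorem tor_dim_ineqs (b := tor_dim res F) :
  [/\ b 3%N <= p * b 2%N, p.+1 * b 2%N <= p.+1 * b 1%N + b 3%N &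
      p.+1 * b 1%N + b 3%N <= p.+1 * (b 0%N + b 2%N)]%N.
Proof.
have h1 := homology_growth sq_complex sq_exact.
have h2 := dim_limg_sqz_exact sq_exact.
have h3 := dim_limg_sqz_map_ge (map_mx res (dmx F 0)) (fibre (dmx F 0)).
rewrite -tauE tau2 in h2; rewrite -tauE in h3.
have h4 := leq_trans h3 (tau_rho 0).
have s0 := sigma_complex 0; have s1 := sigma_complex 1; have s2 := sigma_complex 2.
have t0 := rhoD 0; have t1 := rhoD 1.
have t2 : (rho 0 <= p.+1 * r 0)%N by exact: rank_leq_col.
have t3 : (sigma 0 <= r 0)%N by exact: rank_leq_col.
rewrite /b tor_dim0E !tor_dimSE.
move: h1 h2 h4 s0 s1 s2 t0 t1 t2 t3.
move: (sigma 0) (sigma 1) (sigma 2) (sigma 3) (rho 0) (rho 1) (rho 2).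
move: (r 0) (r 1%N) (r 2) (r 3).
clear; move=> r0 r1 r2 r3 s0 s1 s2 s3 q0 q1 q2 h1 h2 h4 h5 h6 h7 h8 h9 h10 h11.
have -> : (r3 - s2 - s3 = r3 - (s2 + s3))%N by lia.
have -> : (r2 - s1 - s2 = r2 - (s1 + s2))%N by lia.
have -> : (r1 - s0 - s1 = r1 - (s0 + s1))%N by lia.
split; nia.
Qed.

End FreeExtension.

(** * Monomials in two variables *)

Definition exps (a b : nat) : multinom 2 := Multinom [tuple a; b].

Lemma multinom2_eta (m : multinom 2) : m = exps (m ord0) (m ord_max).
Proof.
apply/mnmP => i; rewrite multinomE (tnth_nth 0%N) /=.
case: i => [[|[|//]] hi] /=; congr (m _); exact/val_inj.
Qed.

Lemma exps_ord0 a b : exps a b ord0 = a.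
Proof. by rewrite multinomE (tnth_nth 0%N). Qed.

Lemma exps_ord_max a b : exps a b ord_max = b.
Proof. by rewrite multinomE (tnth_nth 0%N). Qed.

Lemma expsD a b a' b' : mnm_add (exps a b) (exps a' b') = exps (a + a') (b + b').
Proof. by rewrite [LHS]multinom2_eta !mnmDE !exps_ord0 !exps_ord_max. Qed.

Lemma exps00 : exps 0 0 = @mnm0 2.
Proof. by rewrite [RHS]multinom2_eta !mnm0E. Qed.

Lemma eq_exps a b a' b' : (exps a b == exps a' b') = (a == a') && (b == b').
Proof.
apply/eqP/andP => [eq|[/eqP-> /eqP->]//].
have := congr1 (fun m : multinom 2 => m ord0) eq.
have := congr1 (fun m : multinom 2 => m ord_max) eq.
by rewrite !exps_ord0 !exps_ord_max => -> ->.
Qed.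

Lemma mdeg_exps a b : mdeg (exps a b) = (a + b)%N.
Proof. by rewrite /mdeg /= big_cons big_cons big_nil addn0. Qed.

Section Monomials.
Variable k : fieldType.

Definition mono a b : mpoly 2 k := mpolyX k (exps a b).

Lemma mpolyX_mono (m : multinom 2) : mpolyX k m = mono (m ord0) (m ord_max).
Proof. by rewrite {1}[m]multinom2_eta. Qed.

Lemma monoM a b a' b' : mono a b * mono a' b' = mono (a + a') (b + b').
Proof. by rewrite /mono -mpolyXD expsD. Qed.

Lemma mono00 : mono 0 0 = 1.
Proof. by rewrite /mono exps00 mpolyX0. Qed.

Lemma monoX a b n : mono a b ^+ n = mono (a * n) (b * n).
Proof.
elim: n => [|n IH]; first by rewrite !muln0 mono00.
by rewrite exprS IH monoM !mulnS.
Qed.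

Lemma mcoeff_mono a b a' b' :
  mcoeff (exps a b) (mono a' b') = ((a' == a) && (b' == b))%:R.
Proof. by rewrite mcoeffX eq_exps. Qed.

Lemma mono_neq0 a b : mono a b != 0.
Proof.
apply/eqP => /(congr1 (mcoeff (exps a b))).
by rewrite mcoeff_mono !eqxx mcoeff0 => /eqP; rewrite oner_eq0.
Qed.

Lemma mono_dvd a b (f : mpoly 2 k) :
    (forall m, mcoeff m f != 0 -> (a <= m ord0)%N /\ (b <= m ord_max)%N) ->
  f = mono a b *
    (\sum_(m <- msupp f) mcoeff m f *: mono (m ord0 - a) (m ord_max - b)).
Proof.
move=> f_dvd; rewrite mulr_sumr [LHS]mpolyE !big_seq; apply: eq_bigr => m mf.
have [am bm] : (a <= m ord0)%N /\ (b <= m ord_max)%N.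
  by apply: f_dvd; rewrite -mcoeff_msupp.
by rewrite -scalerAr monoM !subnKC // mpolyX_mono.
Qed.

Lemma mcoeff_monoM a b (f : mpoly 2 k) a' b' :
  mcoeff (exps (a + a') (b + b')) (mono a b * f) = mcoeff (exps a' b') f.
Proof. by rewrite mulrC -expsD /mono mcoeffMX. Qed.

Lemma mcoeff_monoM_lt a b (f : mpoly 2 k) (m : multinom 2) :
  ((m ord0 < a) || (m ord_max < b))%N -> mcoeff m (mono a b * f) = 0.
Proof.
move=> m_lt; apply/eqP; rewrite mcoeff_eq0; apply/negP => /msuppM_le.
case/allpairsP => -[m1 m2] /= []; rewrite /mono msuppX mem_seq1 => /eqP -> _ mE.
by move: m_lt; rewrite mE !mnmDE exps_ord0 exps_ord_max; lia.
Qed.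

End Monomials.
Arguments mono : clear implicits.

Fact vval_is_zmod_morphism (k : fieldType) d : zmod_morphism (@vval k d).
Proof. by []. Qed.
HB.instance Definition _ (k : fieldType) d :=
  GRing.isZmodMorphism.Build (veronese k d) (mpoly 2 k) (@vval k d)
    (@vval_is_zmod_morphism k d).

Fact vval_is_monoid_morphism (k : fieldType) d : monoid_morphism (@vval k d).
Proof. by []. Qed.
HB.instance Definition _ (k : fieldType) d :=
  GRing.isMonoidMorphism.Build (veronese k d) (mpoly 2 k) (@vval k d)
    (@vval_is_monoid_morphism k d).

(** * The coordinate ring of the rational normal curve as a free extension *)

Section VeroneseExtension.
Variables (k : fieldType) (p : nat).
Local Notation d := p.+1.
Local Notation B := (veronese k d).
Local Notation A := (mpoly 2 k).

(** Substituting these for the variables identifies k[x, y] with the subring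
    k[x^d, y^d]. *)
Definition power_vars : 2.-tuple A := [tuple mono k d 0; mono k 0 d].
Local Notation lq := power_vars.

Lemma veroneseP (b : B) m : mcoeff m (vval b) != 0 -> (d %| m ord0 + m ord_max)%N.
Proof.
move=> bm; rewrite -mdeg_exps -multinom2_eta.
by have /veronese_predP := valP b; apply.
Qed.

Lemma mono_veronese a b : (d %| a + b)%N -> mono k a b \in veronese_pred k d.
Proof.
move=> dab; apply/veronese_predP => m.
by rewrite mcoeffX; case: (exps a b =P m) => [<-|]; rewrite ?eqxx // mdeg_exps.
Qed.

Lemma veronese_predZ (c : k) (f : A) :
  f \in veronese_pred k d -> c *: f \in veronese_pred k d.
Proof.
move=> /veronese_predP h; apply/veronese_predP => m; rewrite mcoeffZ => cf.
by apply: h; apply: contraNneq cf => ->; rewrite mulr0.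
Qed.

Lemma comp_mono a b : comp_mpoly lq (mono k a b) = mono k (a * d) (b * d).
Proof.
rewrite comp_mpolyX big_ord_recl big_ord1 /= exps_ord0.
rewrite !(tnth_nth 0) /= monoX.
have -> : exps a b (lift ord0 ord0) = b.
  by rewrite -[RHS](exps_ord_max a b); congr (_ _); apply/val_inj.
by rewrite monoX monoM !mul0n addn0 add0n ![(d * _)%N]mulnC.
Qed.

Lemma comp_sum (f : A) : comp_mpoly lq f =
  \sum_(m <- msupp f) mcoeff m f *: mono k (m ord0 * d) (m ord_max * d).
Proof.
rewrite comp_mpolyEX; apply: eq_bigr => m _.
by rewrite mpolyX_mono comp_mono.
Qed.

Lemma comp_veronese (f : A) : comp_mpoly lq f \in veronese_pred k d.
Proof.
rewrite comp_sum; apply: rpred_sum => m _; apply: veronese_predZ.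
by apply: mono_veronese; rewrite -mulnDl dvdn_mull.
Qed.

Definition frob (f : A) : B := Veronese (comp_veronese f).

Fact frob_is_zmod_morphism : zmod_morphism frob.
Proof. by move=> f g; apply: val_inj; rewrite /= !raddfB. Qed.
HB.instance Definition _ :=
  GRing.isZmodMorphism.Build A B frob frob_is_zmod_morphism.

Fact frob_is_monoid_morphism : monoid_morphism frob.
Proof. by split=> [|f g]; apply: val_inj; rewrite /= ?rmorph1 // !rmorphM. Qed.
HB.instance Definition _ :=
  GRing.isMonoidMorphism.Build A B frob frob_is_monoid_morphism.

(** The exponent of y in the basis monomial with x-exponent l. *)
Definition codeg (l : 'I_(1 + p)) : nat := if l == 0 :> nat then 0%N else (d - l)%N.

Fact basis_proof (l : 'I_(1 + p)) : mono k l (codeg l) \in veronese_pred k d.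
Proof.
apply: mono_veronese; rewrite /codeg; case: eqP => [->//|l0].
by rewrite subnKC ?dvdnn // ltnW.
Qed.

Definition basis (l : 'I_(1 + p)) : B := Veronese (basis_proof l).

Lemma vval_basis_sum (a : 'I_(1 + p) -> A) :
  vval (\sum_l frob (a l) * basis l) =
  \sum_(l < 1 + p) mono k l (codeg l) * comp_mpoly lq (a l).
Proof. by rewrite raddf_sum; apply: eq_bigr => l _; rewrite /= mulrC. Qed.

(** The basis monomials have x-exponents that are distinct modulo d, so no two
    summands share a monomial. *)
Lemma mcoeff_basis_sum (a : 'I_(1 + p) -> A) (l : 'I_(1 + p)) i j :
  mcoeff (exps (l + i * d) (codeg l + j * d)) (vval (\sum_l frob (a l) * basis l)) =
  mcoeff (exps i j) (a l).
Proof.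
rewrite vval_basis_sum raddf_sum (bigD1 l) //= mcoeff_monoM comp_sum.
rewrite [X in _ + X]big1 ?addr0 => [|l' l'l]; last first.
  rewrite comp_sum mulr_sumr raddf_sum big1 // => m _ /=.
  rewrite -scalerAr monoM mcoeffZ mcoeff_mono.
  case: eqP; last by rewrite mulr0.
  move=> /(congr1 (modn^~ d)); rewrite ![(_ + _ * d)%N]addnC !modnMDl !modn_small // => ll'.
  by case/eqP: l'l; apply: val_inj.
rewrite raddf_sum /= (eq_bigr (fun m => mcoeff m (a l) * (m == exps i j)%:R)).
  have [la|la] := boolP (exps i j \in msupp (a l)).
    rewrite (bigD1_seq (exps i j)) //= ?msupp_uniq // eqxx mulr1 big1 ?addr0 //.
    by move=> m /negPf ->; rewrite mulr0.
  rewrite big_seq big1 ?(memN_msupp_eq0 la) // => m ma.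
  by case: eqP ma la => [-> ->//|]; rewrite mulr0.
move=> m _; rewrite mcoeffZ mcoeff_mono !eqn_pmul2r //.
by congr (_ * _); rewrite [in RHS](multinom2_eta m) eq_exps.
Qed.

Lemma basis_free (a : 'I_(1 + p) -> A) :
  \sum_l frob (a l) * basis l = 0 -> forall l, a l = 0.
Proof.
move=> a0 l; apply/mpolyP => m; rewrite [m]multinom2_eta -mcoeff_basis_sum a0.
by rewrite /= !mcoeff0.
Qed.

(** The x-exponent modulo d selects the basis monomial that divides a monomial
    of B with quotient in k[x^d, y^d]. *)
Lemma basis_span (b : B) : exists a : 'I_(1 + p) -> A,
  \sum_l frob (a l) * basis l = b.
Proof.
have mono_span (m : multinom 2) (c : k) : (d %| m ord0 + m ord_max)%N ->
    exists a : 'I_(1 + p) -> A,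
    vval (\sum_l frob (a l) * basis l) = c *: mpolyX k m.
  move=> dm; pose l : 'I_(1 + p) := Ordinal (ltn_pmod (m ord0) (ltn0Sn p)).
  exists (fun i => if i == l then c *: mono k (m ord0 %/ d) (m ord_max %/ d) else 0).
  rewrite vval_basis_sum (bigD1 l) //= eqxx big1 ?addr0; last first.
    by move=> i /negPf ->; rewrite raddf0 mulr0.
  rewrite comp_mpolyZ comp_mono -scalerAr monoM mpolyX_mono; congr (_ *: mono _ _ _).
    by rewrite addnC -divn_eq.
  suff -> : codeg l = (m ord_max %% d)%N by rewrite addnC -divn_eq.
  rewrite /codeg /=; move: dm; rewrite /dvdn -modnDm.
  move: (ltn_pmod (m ord0) (ltn0Sn p)) (ltn_pmod (m ord_max) (ltn0Sn p)).
  move: (m ord0 %% d)%N (m ord_max %% d)%N => x y xd yd.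
  case: (x =P 0%N) => [->|x0]; first by rewrite add0n modn_small // => /eqP.
  have [xy|xy] := ltnP (x + y) d; first by rewrite modn_small //; lia.
  rewrite -{1}(subnK xy) modnDr modn_small; lia.
have [a aE] : exists a : 'I_(1 + p) -> A,
    vval (\sum_l frob (a l) * basis l) =
    \sum_(m <- msupp (vval b)) mcoeff m (vval b) *: mpolyX k m.
  rewrite big_seq; apply: (big_ind (fun f => exists a : 'I_(1 + p) -> A,
    vval (\sum_l frob (a l) * basis l) = f)) => [|f g [a <-] [a' <-]|m mb].
  - by exists (fun=> 0); rewrite big1 // => l _; rewrite raddf0 mul0r.
  - exists (fun l => a l + a' l); rewrite -raddfD -big_split /=; congr vval.
    by apply: eq_bigr => l _; rewrite raddfD mulrDl.
  - by apply: mono_span; apply: (@veroneseP b); rewrite -mcoeff_msupp.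
by exists a; apply: val_inj; rewrite /= aE -mpolyE.
Qed.

Definition fibre_coeff (j : 'I_p) : B -> k :=
  mcoeff (exps j.+1 (p - j)) \o @vval k d.

Fact fibre_coeff_is_zmod_morphism j : zmod_morphism (fibre_coeff j).
Proof. by move=> x y; rewrite /fibre_coeff /= !raddfB. Qed.
HB.instance Definition _ j :=
  GRing.isZmodMorphism.Build B k (fibre_coeff j) (fibre_coeff_is_zmod_morphism j).

Lemma residue_basis (a : 'I_(1 + p) -> A) :
  residue (\sum_l frob (a l) * basis l) = mcoeff (@mnm0 2) (a (lshift p 0)).
Proof.
have := mcoeff_basis_sum a (lshift p 0) 0 0.
by rewrite /codeg /= !mul0n !addn0 exps00.
Qed.

Lemma fibre_basis j (a : 'I_(1 + p) -> A) :
  fibre_coeff j (\sum_l frob (a l) * basis l) = mcoeff (@mnm0 2) (a (rshift 1 j)).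
Proof.
have := mcoeff_basis_sum a (rshift 1 j) 0 0.
by rewrite exps00 /codeg /= !mul0n !addn0 add1n /= subSS.
Qed.

(** A monomial of degree d is a product of monomials of B in two ways only, since
    these have degrees divisible by d: one of the factors is constant. *)
Lemma fibre_coeffM j (x y : B) :
  fibre_coeff j (x * y) =
  residue x * fibre_coeff j y + fibre_coeff j x * residue y.
Proof.
set m := exps j.+1 (p - j); have jp := ltn_ord j.
have nz : mcoeff m (1 : A) = 0 by rewrite mcoeff1 -exps00 eq_exps.
pose x' := vval x - mpolyC 2 (residue x); pose y' := vval y - mpolyC 2 (residue y).
have xy0 : mcoeff m (x' * y') = 0.
  apply/eqP; rewrite mcoeff_eq0; apply/negP => /msuppM_le.
  have pos (z : B) (n : multinom 2) :
      n \in msupp (vval z - mpolyC 2 (residue z)) -> (d <= n ord0 + n ord_max)%N.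
    rewrite mcoeff_msupp mcoeffB mcoeffC.
    have [->|n0] := eqVneq n (@mnm0 2); first by rewrite mulr1 subrr eqxx.
    rewrite mulr0 subr0 => /veroneseP; apply: dvdn_leq.
    rewrite lt0n; apply: contraNneq n0 => n0.
    by rewrite -exps00 [n]multinom2_eta eq_exps; lia.
  case/allpairsP => -[m1 m2] /= [/pos m1d /pos m2d mE].
  have := congr1 (@mdeg 2) mE; rewrite mdeg_exps mdegD.
  by rewrite [m1]multinom2_eta [m2]multinom2_eta !mdeg_exps; lia.
have xE : vval x = x' + mpolyC 2 (residue x) by rewrite subrK.
have yE : vval y = y' + mpolyC 2 (residue y) by rewrite subrK.
have -> : fibre_coeff j (x * y) =
    mcoeff m ((x' + mpolyC 2 (residue x)) * (y' + mpolyC 2 (residue y))).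
  by rewrite -xE -yE.
have cm c : mcoeff m (mpolyC 2 c : A) = 0.
  by rewrite -[mpolyC 2 c]mulr1 mcoeffCM nz mulr0.
have x'm : mcoeff m x' = fibre_coeff j x by rewrite mcoeffB cm subr0.
have y'm : mcoeff m y' = fibre_coeff j y by rewrite mcoeffB cm subr0.
move: x' y' xy0 x'm y'm {xE yE} => x' y' xy0 x'm y'm.
rewrite mulrDl !mulrDr !mcoeffD xy0 add0r -mpolyCM cm addr0 [x' * _]mulrC.
by rewrite !mcoeffCM x'm y'm addrC [_ * residue y]mulrC.
Qed.

(** No monomial of y b is a power of x, so each monomial of a is divisible
    by y. *)
Lemma mono_regular (a b : A) : mono k 1 0 * a + mono k 0 1 * b = 0 ->
  exists c, a = mono k 0 1 * c /\ b = - (mono k 1 0 * c).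
Proof.
move=> ab0; have aE := @mono_dvd k 0 1 a; set c := \sum_(_ <- _) _ in aE.
have {}aE : a = mono k 0 1 * c.
  apply: aE => m am; split=> //; rewrite lt0n; apply: contraNneq am => m1.
  have := congr1 (mcoeff (exps (1 + m ord0) (0 + m ord_max))) ab0.
  rewrite mcoeffD mcoeff_monoM -multinom2_eta mcoeff0.
  by rewrite mcoeff_monoM_lt ?addr0 ?exps_ord_max ?m1 ?orbT // => ->.
exists c; split=> //; apply: (mulfI (mono_neq0 k 0 1)).
apply/eqP; rewrite -subr_eq0 -ab0 [in X in _ == X]aE; apply/eqP; ring.
Qed.

Lemma mono_max (a : A) : mcoeff (@mnm0 2) a = 0 ->
  exists b c, a = mono k 1 0 * b + mono k 0 1 * c.
Proof.
move=> a0; rewrite [a]mpolyE big_seq.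
apply: (big_ind (fun f => exists b c,
  f = mono k 1 0 * b + mono k 0 1 * c)) => [|f g [b [c ->]] [b' [c' ->]]|m].
- by exists 0, 0; rewrite !mulr0 addr0.
- by exists (b + b'), (c + c'); rewrite !mulrDr addrACA.
rewrite mcoeff_msupp [m]multinom2_eta.
move: (m ord0) (m ord_max) => [|i] [|j] am.
- by move: am; rewrite exps00 a0 eqxx.
- exists 0, (mcoeff (exps 0 j.+1) a *: mono k 0 j).
  by rewrite mulr0 add0r -scalerAr monoM.
- exists (mcoeff (exps i.+1 0) a *: mono k i 0), 0.
  by rewrite mulr0 addr0 -scalerAr monoM.
- exists (mcoeff (exps i.+1 j.+1) a *: mono k i j.+1), 0.
  by rewrite mulr0 addr0 -scalerAr monoM.
Qed.

Theorem veronese_tor_ineqs (M : lmodType B) (F : free_resolution M)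
    (b := tor_dim (@residue k d) F) :
  [/\ b 3%N <= p * b 2%N, d * b 2%N <= d * b 1%N + b 3%N &
      d * b 1%N + b 3%N <= d * (b 0%N + b 2%N)]%N.
Proof.
have [coord coordK] := boolp.choice basis_span.
apply: (@tor_dim_ineqs A k B p (mcoeff (@mnm0 2)) (@mpolyC 2 k) (@mpolyCK 2 k)
  (mono k 1 0) (mono k 0 1) (mono_neq0 k 0 1) mono_regular _ _ mono_max frob basis
  coord coordK basis_free (@residue k d) fibre_coeff residue_basis fibre_basis
  fibre_coeffM).
- by rewrite /= -exps00 mcoeff_mono.
- by rewrite /= -exps00 mcoeff_mono.
Qed.

End VeroneseExtension.

(** * Graded Nakayama *)

Section ZeroModule.
Variables (R : comNzRingType) (k : fieldType) (res : {rmorphism R -> k}).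
Variables (M : lmodType R) (F : free_resolution M).

Lemma rows_factor m n q (X : 'M[R]_(q, n)) (P : 'M[R]_(m, n)) :
  (forall i, exists w, row i X = w *m P) -> exists H, X = H *m P.
Proof.
move=> /fin_all_exists[w wP]; exists (\matrix_i w i).
by apply/row_matrixP => i; rewrite row_mul rowK.
Qed.

(** A resolution of zero splits: inductively there are maps h with d h d = d, and
    then 1 - d h factors through the next differential. These identities survive
    the reduction to the residue field and bound the sum of consecutive ranks
    from below. *)
Lemma tor_dim_zero_module : (forall z : M, z = 0) -> forall i, tor_dim res F i = 0%N.
Proof.
move=> M0.
have [h0 h0P] : exists H, 1%:M = H *m dmx F 0.
  by apply: rows_factor => i; apply/aug_exact/M0.
have step i h : dmx F i *m h *m dmx F i = dmx F i ->
    exists h', 1%:M - dmx F i *m h = h' *m dmx F i.+1.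
  move=> hP; apply: rows_factor => j; apply/dmx_exact.
  by rewrite -row_mul mulmxBl mul1mx hP subrr row0.
have htpy i : exists h, dmx F i *m h *m dmx F i = dmx F i.
  elim: i => [|i [h hP]]; first by exists h0; rewrite -mulmxA -h0P mulmx1.
  have [h' h'P] := step i h hP; exists h'.
  by rewrite -mulmxA -h'P mulmxBr mulmx1 mulmxA dmx_complex mul0mx subr0.
case=> [|i].
  apply/eqP; rewrite tor_dim0E subn_eq0 -[X in (X <= _)%N](mxrank1 k).
  by rewrite -(map_mx1 res) h0P map_mxM mxrankM_maxr.
have [h hP] := htpy i; have [h' h'P] := step i h hP.
apply/eqP; rewrite tor_dimSE -subnDA subn_eq0 -[X in (X <= _)%N](mxrank1 k).
rewrite -(map_mx1 res) -[1%:M](subrK (dmx F i *m h)) h'P map_mxD !map_mxM addrC.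
apply: leq_trans (mxrank_add _ _) _.
by rewrite leq_add ?mxrankM_maxl ?mxrankM_maxr.
Qed.

End ZeroModule.

Section Nakayama.
Variables (k : fieldType) (d : nat) (d_gt0 : (0 < d)%N).
Local Notation B := (veronese k d).

Fact const_proof (c : k) : mpolyC 2 c \in veronese_pred k d.
Proof.
apply/veronese_predP => m; rewrite mcoeffC.
by case: (m =P _) => [->|]; rewrite ?mdeg0 ?dvdn0 // mulr0 eqxx.
Qed.
Definition const (c : k) : B := Veronese (const_proof c).

Lemma constK : cancel const (@residue k d).
Proof. exact: mpolyCK. Qed.

(** If b_0 = 0, then the first differential is surjective modulo B_+, which means
    M = B_+ M. *)
Lemma tor_dim0_module (M : lmodType B) (F : free_resolution M) :
  tor_dim (@residue k d) F 0 = 0%N -> forall z : M,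
  exists n (b : 'I_n -> B) (y : 'I_n -> M),
    (forall i, residue (b i) = 0) /\ z = \sum_i b i *: y i.
Proof.
move=> /eqP; rewrite tor_dim0E subn_eq0 => full z.
have /row_fullP[C CD] : row_full (map_mx (@residue k d) (dmx F 0)).
  by rewrite /row_full eqn_leq rank_leq_col.
have [v <-] := aug_surj F z.
set D := dmx F 0 in full CD *; set C' := map_mx const C.
pose w := v - v *m C' *m D.
have -> : aug F v = aug F w.
  rewrite linearB /=; have -> : aug F (v *m C' *m D) = 0 by apply/aug_exact; eexists.
  by rewrite subr0.
exists (rk F 0), (fun i => w 0 i), (fun i => aug F (delta_mx 0 i)); split.
  have : map_mx (@residue k d) w = 0.
    rewrite map_mxB !map_mxM; have -> : map_mx (@residue k d) C' = C.
      by apply/matrixP => i j; rewrite !mxE constK.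
    by rewrite -mulmxA CD mulmx1 subrr.
  by move=> /rowP w0 i; have := w0 i; rewrite !mxE.
rewrite {1}[w]row_sum_delta linear_sum; apply: eq_bigr => i _.
by rewrite linearZ.
Qed.

(** The monomials of b with their coefficients, as elements of B; the value is
    meaningful for m in the support of b. *)
Definition term (b : B) (m : multinom 2) : B := insubd 0 (mcoeff m (vval b) *: mpolyX k m).

Lemma vval_term b m : m \in msupp (vval b) ->
  vval (term b m) = mcoeff m (vval b) *: mpolyX k m.
Proof.
move=> mb; apply: insubdK; apply/veronese_predP => m'.
rewrite mcoeffZ mcoeffX; case: (m =P m') => [<- _|]; last by rewrite mulr0 eqxx.
by have /allP := valP b; apply.
Qed.

Lemma term_deg b m : m \in msupp (vval b) -> veronese_deg k d (mdeg m %/ d) (term b m).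
Proof.
move=> mb; rewrite /veronese_deg /= vval_term // divnK; last first.
  by have /allP := valP b; apply.
by rewrite dhomogZ // dhomogX.
Qed.

Lemma term_sum b : b = \sum_(m <- msupp (vval b)) term b m.
Proof.
apply: val_inj; rewrite /= raddf_sum /= [LHS]mpolyE !big_seq.
by apply: eq_bigr => m mb; rewrite vval_term.
Qed.

Variables (M : lmodType B) (gr : int -> set M) (grM : is_grading gr).

Lemma grD n x y : gr n x -> gr n y -> gr n (x + y).
Proof.
move=> gx gy; rewrite -[y]opprK; apply: (grB grM) => //.
by rewrite -sub0r; apply: (grB grM) => //; exact: gr0.
Qed.

(** The sum of the M_n with n >= j, in terms of lists of homogeneous elements, so
    that several summands may have the same degree. *)
Definition gr_ge (j : int) (z : M) : Prop := exists l : seq (int * M),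
  (forall q, q \in l -> j <= q.1 /\ gr q.1 q.2) /\ z = \sum_(q <- l) q.2.

Lemma gr_ge0 j : gr_ge j 0.
Proof. by exists [::]; split=> //; rewrite big_nil. Qed.

Lemma gr_geD j x y : gr_ge j x -> gr_ge j y -> gr_ge j (x + y).
Proof.
move=> [l [lj ->]] [l' [lj' ->]]; exists (l ++ l'); rewrite big_cat; split=> // q.
by rewrite mem_cat => /orP[/lj|/lj'].
Qed.

Lemma gr_ge_sum (I : eqType) (r : seq I) (f : I -> M) j :
  (forall i, i \in r -> gr_ge j (f i)) -> gr_ge j (\sum_(i <- r) f i).
Proof.
move=> fj; rewrite big_seq; apply: big_ind => //; first exact: gr_ge0.
exact: gr_geD.
Qed.

Lemma gr_ge_le j j' z : j' <= j -> gr_ge j z -> gr_ge j' z.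
Proof.
move=> jj [l [lj ->]]; exists l; split=> // q /lj[jq gq]; split=> //.
exact: le_trans jq.
Qed.

Lemma gr_geZ j (i : nat) (b : B) z :
  (forall m, m \in msupp (vval b) -> (i <= mdeg m %/ d)%N) ->
  gr_ge j z -> gr_ge (i%:Z + j) (b *: z).
Proof.
move=> bi [l [lj ->]]; rewrite [b]term_sum scaler_suml.
apply: gr_ge_sum => m mb; rewrite scaler_sumr; apply: gr_ge_sum => q /lj[jq gq].
exists [:: ((mdeg m %/ d)%N%:Z + q.1, term b m *: q.2)]; rewrite big_seq1; split=> //.
move=> q'; rewrite mem_seq1 => /eqP -> /=; split; first by rewrite lerD // lez_nat bi.
exact: (grZ grM) (term_deg mb) gq.
Qed.

Lemma gr_ge_residue0 j (b : B) z : residue b = 0 -> gr_ge j z -> gr_ge (1 + j) (b *: z).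
Proof.
move=> b0; apply: (@gr_geZ j 1) => m mb.
rewrite divn_gt0 // dvdn_leq //; last by have /allP := valP b; apply.
rewrite lt0n mdeg_eq0; apply: contraTneq mb => ->.
by rewrite mcoeff_msupp negbK; apply/eqP.
Qed.

Lemma gr_ge_exists z : exists j, gr_ge j z.
Proof.
have [s [c [gc ->]]] := gr_span grM z.
exists (- \sum_(n <- s) `|n|), [seq (n, c n) | n <- s]; rewrite big_map; split=> //.
move=> _ /mapP[n ns ->] /=; split=> //; rewrite lerNl.
rewrite (le_trans (ler_norm _)) // normrN.
elim: s ns => // a s IH; rewrite inE big_cons => /orP[/eqP ->|/IH h].
  by rewrite lerDl sumr_ge0.
by rewrite (le_trans h) // lerDr.
Qed.

Lemma gr_ge_fg : finitely_generated M -> exists j, forall z, gr_ge j z.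
Proof.
move=> [n [g gP]]; have /fin_all_exists[j jP] := fun i => gr_ge_exists (g i).
exists (- \sum_i `|j i|) => z; have [c ->] := gP z.
apply: gr_ge_sum => i _; rewrite -[X in gr_ge X]add0r.
apply: gr_geZ => //; apply: gr_ge_le (jP i); rewrite lerNl.
rewrite (le_trans (ler_norm _)) // normrN (bigD1 i) //= lerDl sumr_ge0 //.
Qed.

(** The components of z occur in finitely many degrees; writing z also with
    components in larger degrees only, directness of the sum annihilates all of
    them. *)
Lemma gr_ge_all_zero z : (forall j, gr_ge j z) -> z = 0.
Proof.
move=> zj; have [s [c [gc zs]]] := gr_span grM z.
pose J := 1 + \sum_(n <- s) `|n|; have [l [lJ zl]] := zj J.
have sJ n : n \in s -> n < J.
  move=> ns; rewrite /J ltz1D (le_trans (ler_norm _)) //.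
  by rewrite (big_rem n) //= lerDl sumr_ge0.
pose L := [seq (n, c n) | n <- s] ++ [seq (q.1, - q.2) | q <- l].
pose U := undup [seq q.1 | q <- L].
pose C n := \sum_(q <- L) if q.1 == n then q.2 else 0.
have gL q : q \in L -> gr q.1 q.2.
  rewrite mem_cat => /orP[/mapP[n ns ->] //|/mapP[q' /lJ[_ gq'] ->] /=].
  by rewrite -sub0r; apply: (grB grM) => //; exact: gr0.
have gC n : gr n (C n).
  rewrite /C big_seq; apply: big_ind => [|x y gx gy|q qL]; first exact: gr0.
    exact: grD.
  by case: eqP => [<-|_]; [exact: gL|exact: gr0].
have sumU : \sum_(n <- U) C n = 0.
  transitivity (\sum_(q <- L) q.2); last first.
    by rewrite big_cat !big_map /= sumrN -zl -zs subrr.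
  rewrite exchange_big !big_seq; apply: eq_bigr => q qL.
  rewrite (bigD1_seq q.1) ?undup_uniq //=; last first.
    by rewrite mem_undup map_f.
  by rewrite eqxx big1 ?addr0 // => n; rewrite eq_sym => /negPf ->.
have C0 := gr_direct grM (undup_uniq _) gC sumU.
rewrite zs; transitivity (\sum_(n <- undup s) C n); last first.
  rewrite big_seq big1 // => n; rewrite mem_undup => ns; apply: C0.
  by rewrite mem_undup map_cat mem_cat -map_comp map_f.
transitivity (\sum_(n <- undup s) \sum_(n' <- s) if n' == n then c n' else 0).
  rewrite exchange_big big_seq [RHS]big_seq; apply: eq_bigr => n ns.
  rewrite (bigD1_seq n) ?undup_uniq ?mem_undup //= eqxx big1 ?addr0 //.
  by move=> n'; rewrite eq_sym => /negPf ->.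
rewrite big_seq [RHS]big_seq; apply: eq_bigr => n; rewrite mem_undup => ns.
rewrite /C big_cat !big_map /= [X in _ + X]big1_seq ?addr0 // => q /= /lJ[Jq _].
by case: eqP => // qn; have := sJ n ns; rewrite -qn ltNge Jq.
Qed.

(** Multiplication by B_+ raises degrees, so M = B_+ M pushes M, which is
    concentrated in degrees >= j0, into arbitrarily large degrees. *)
Lemma graded_nakayama : finitely_generated M ->
  (forall z : M, exists n (b : 'I_n -> B) (y : 'I_n -> M),
    (forall i, residue (b i) = 0) /\ z = \sum_i b i *: y i) ->
  forall z : M, z = 0.
Proof.
move=> /gr_ge_fg[j0 j0P] mM z.
have up (n : nat) x : gr_ge (n%:Z + j0) x.
  elim: n x => [|n IH] x; first by rewrite add0r.
  have [q [b [y [b0 ->]]]] := mM x; apply: gr_ge_sum => i _.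
  by rewrite intS -addrA; apply: gr_ge_residue0.
apply: gr_ge_all_zero => j; apply: gr_ge_le (up `|j - j0|%N z).
by rewrite -lerBlDr abszE ler_norm.
Qed.

End Nakayama.

Lemma total_betti_zero (k : fieldType) (d : nat) (M : lmodType (veronese k d))
    (b : nat -> nat) : (0 < d)%N ->
  graded M -> finitely_generated M -> total_betti M b -> b 0%N = 0%N ->
  forall i, b i = 0%N.
Proof.
move=> d0 [gr grM] fgM [F bF] b0 i; rewrite bF; apply: tor_dim_zero_module.
apply: graded_nakayama grM fgM _ => //; apply: tor_dim0_module.
by move: b0; rewrite bF; exact.
Qed.

(** * Graded cokernels *)

Section Cokernel.
Variables (R : comNzRingType) (m n : nat) (D : 'M[R]_(m, n)).

Definition rowspace : {pred 'rV[R]_n} := fun v => `[< exists w, v = w *m D >].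

Lemma rowspaceP v : reflect (exists w, v = w *m D) (v \in rowspace).
Proof. exact: asboolP. Qed.

Fact rowspace_zmod_closed : zmod_closed rowspace.
Proof.
split=> [|v w /rowspaceP[x ->] /rowspaceP[y ->]]; apply/rowspaceP.
  by exists 0; rewrite mul0mx.
by exists (x - y); rewrite mulmxBl.
Qed.

HB.instance Definition _ :=
  GRing.isZmodClosed.Build 'rV[R]_n rowspace rowspace_zmod_closed.

Lemma rowspaceZ a v : v \in rowspace -> a *: v \in rowspace.
Proof.
by move=> /rowspaceP[w ->]; apply/rowspaceP; exists (a *: w); rewrite scalemxAl.
Qed.

Definition coker : Type := Quotient.quot rowspace.
HB.instance Definition _ := GRing.Zmodule.on coker.
HB.instance Definition _ := ZmodQuotient.on coker.

Definition coker_scale (a : R) : coker -> coker := lift_op1 coker ( *:%R a).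

Lemma pi_scale a : {morph \pi_coker%qT : x / a *: x >-> coker_scale a x}.
Proof.
move=> x; unlock coker_scale; apply/eqP; rewrite -Quotient.idealrBE -scalerBr.
by rewrite rowspaceZ // Quotient.idealrBE reprK.
Qed.

Lemma coker_scaleA a b x : coker_scale a (coker_scale b x) = coker_scale (a * b) x.
Proof. by rewrite -[x]reprK -!pi_scale scalerA. Qed.

Lemma coker_scale1 : left_id 1 coker_scale.
Proof. by move=> x; rewrite -[x]reprK -pi_scale scale1r. Qed.

Lemma coker_scaleDr : right_distributive coker_scale +%R.
Proof.
by move=> a x y; rewrite -[x]reprK -[y]reprK -raddfD -!pi_scale -raddfD scalerDr.
Qed.

Lemma coker_scaleDl x : {morph coker_scale^~ x : a b / a + b}.
Proof. by move=> a b; rewrite -[x]reprK -!pi_scale -raddfD scalerDl. Qed.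

HB.instance Definition _ :=
  GRing.Zmodule_isLmodule.Build R coker coker_scaleA coker_scale1
    coker_scaleDr coker_scaleDl.

Definition coker_pi (v : 'rV[R]_n) : coker := (\pi_coker v)%qT.

Fact coker_pi_is_linear : linear coker_pi.
Proof. by move=> a v w; rewrite /coker_pi raddfD; congr (_ + _); exact: pi_scale. Qed.

HB.instance Definition _ :=
  GRing.isLinear.Build R 'rV[R]_n coker _ coker_pi coker_pi_is_linear.

Lemma coker_pi_surj z : exists v, coker_pi v = z.
Proof. by exists (repr z); rewrite /coker_pi reprK. Qed.

Lemma coker_pi_eq0 v : coker_pi v = 0 <-> exists w, v = w *m D.
Proof.
have eqv : (v \in rowspace) = (coker_pi v == 0).
  by rewrite -(raddf0 coker_pi) -{1}[v]subr0 Quotient.idealrBE.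
split=> [v0|vD]; first by apply/rowspaceP; rewrite eqv v0.
by apply/eqP; rewrite -eqv; apply/rowspaceP.
Qed.

Lemma coker_fg : finitely_generated coker.
Proof.
exists n, (fun i => coker_pi (delta_mx 0 i)) => z; have [v <-] := coker_pi_surj z.
exists (fun i => v 0 i); rewrite {1}[v]row_sum_delta linear_sum.
by apply: eq_bigr => i _; rewrite linearZ.
Qed.

End Cokernel.

Section GradedCokernel.
Variables (k : fieldType) (d : nat) (d_gt0 : (0 < d)%N).
Local Notation B := (veronese k d).

Lemma mcoeff_pihomog e (f : mpoly 2 k) m :
  mcoeff m (pihomog (@mdeg 2) e f) = if mdeg m == e then mcoeff m f else 0.
Proof.
rewrite pihomogE raddf_sum /= big_mkcond /=.
have [mf|mf] := boolP (m \in msupp f).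
  rewrite (bigD1_seq m) ?msupp_uniq //= big1 ?addr0 => [|m' m'm].
    by case: ifP; rewrite // mcoeffZ mcoeffX eqxx mulr1.
  by case: ifP => // _; rewrite mcoeffZ mcoeffX (negPf m'm) mulr0.
rewrite (memN_msupp_eq0 mf) if_same big_seq big1 // => m' m'f.
case: ifP => // _; rewrite mcoeffZ mcoeffX.
by case: eqP m'f mf => [-> ->//|]; rewrite mulr0.
Qed.

Fact component_proof n (b : B) :
  pihomog (@mdeg 2) (n * d) (vval b) \in veronese_pred k d.
Proof.
apply/veronese_predP => m; rewrite mcoeff_pihomog.
by case: (mdeg m =P _) => [-> _|_]; rewrite ?dvdn_mull ?eqxx.
Qed.

Definition component n (b : B) : B := Veronese (component_proof n b).

Fact component_is_zmod_morphism n : zmod_morphism (component n).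
Proof. by move=> x y; apply: val_inj; rewrite /= raddfB. Qed.
HB.instance Definition _ n :=
  GRing.isZmodMorphism.Build B B (component n) (component_is_zmod_morphism n).

Lemma component_deg n b : veronese_deg k d n (component n b).
Proof. exact: pihomogP. Qed.

Lemma component_homog n n' b : veronese_deg k d n b ->
  component n' b = if n == n' then b else 0.
Proof.
move=> bn; apply: val_inj; case: eqP => [<-|/eqP nn'] /=.
  exact: pihomog_dE.
by apply: pihomog_ne0 bn; rewrite eqn_pmul2r // eq_sym.
Qed.

Lemma component_sum (b : B) : exists N0, forall N, (N0 <= N)%N ->
  b = \sum_(n < N) component n b.
Proof.
exists (\sum_(m <- msupp (vval b)) mdeg m).+1 => N N0N; apply: val_inj => /=.
rewrite raddf_sum /=; apply/mpolyP => m; rewrite raddf_sum /=.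
rewrite (eq_bigr (fun n : 'I_N => if mdeg m == (n * d)%N then mcoeff m (vval b) else 0)).
  have [mb|mb] := boolP (m \in msupp (vval b)); last first.
    by rewrite (memN_msupp_eq0 mb) big1 // => n _; rewrite if_same.
  have dm : (d %| mdeg m)%N by have /allP := valP b; apply.
  have mN : (mdeg m %/ d < N)%N.
    apply: leq_trans N0N; rewrite ltnS; apply: leq_trans (leq_div _ _) _.
    by rewrite (big_rem m) //= leq_addr.
  rewrite (bigD1 (Ordinal mN)) //= divnK // eqxx big1 ?addr0 // => n nm.
  case: eqP => // mE; case/eqP: nm; apply: val_inj => /=.
  by rewrite mE mulnK.
by move=> n _; rewrite mcoeff_pihomog.
Qed.

Lemma veronese_degM i j (a b : B) : veronese_deg k d i a -> veronese_deg k d j b ->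
  veronese_deg k d (i + j) (a * b).
Proof. by move=> ai bj; rewrite /veronese_deg /= mulnDl dhomogM. Qed.

Lemma veronese_deg0 i : veronese_deg k d i 0.
Proof. exact: dhomog0. Qed.

Lemma veronese_degB i (a b : B) : veronese_deg k d i a -> veronese_deg k d i b ->
  veronese_deg k d i (a - b).
Proof. by move=> ai bj; rewrite /veronese_deg /= rpredB. Qed.

Lemma component_mul n e (b c : B) : veronese_deg k d e c ->
  component n (b * c) = if (e <= n)%N then component (n - e) b * c else 0.
Proof.
move=> ce; have [N0 bN] := component_sum b; set N := maxn N0 n.+1.
rewrite {1}(bN N (leq_maxl _ _)) mulr_suml raddf_sum /=.
rewrite (eq_bigr (fun i : 'I_N => if (i + e == n)%N then component i b * c else 0)).
  case: leqP => [en|ne].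
    have nN : (n - e < N)%N by rewrite /N; lia.
    rewrite (bigD1 (Ordinal nN)) //= subnK // eqxx big1 ?addr0 // => i ine.
    by case: eqP => // iE; case/eqP: ine; apply: val_inj; rewrite /=; lia.
  by rewrite big1 // => i _; case: eqP => //; lia.
move=> i _; apply: component_homog.
exact: veronese_degM (component_deg _ _) ce.
Qed.

Variables (r n : nat) (e : nat) (D : 'M[B]_(r, n)).
Hypothesis D_deg : forall i j, veronese_deg k d e (D i j).

(** B is zero in negative degrees. *)
Definition row_deg (j : int) (v : 'rV[B]_n) : Prop :=
  if j is Posz i then forall l, veronese_deg k d i (v 0 l) else v = 0.

Definition coker_gr (j : int) : set (coker D) :=
  [set z | exists2 v, row_deg j v & z = coker_pi D v]%classic.

Lemma row_deg0 j : row_deg j 0.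
Proof. by case: j => // i l; rewrite mxE; exact: veronese_deg0. Qed.

(** A submodule generated by homogeneous elements contains the homogeneous
    components of its elements. *)
Lemma map_component_rowspace i v :
  v \in rowspace D -> map_mx (component i) v \in rowspace D.
Proof.
move=> /rowspaceP[w ->]; apply/rowspaceP.
exists (if (e <= i)%N then map_mx (component (i - e)) w else 0).
apply/rowP => l; rewrite !mxE raddf_sum; case: leqP => ei.
  by apply: eq_bigr => a _; rewrite /= (component_mul _ _ (D_deg a l)) ei !mxE.
rewrite !big1 // => a _; rewrite ?mxE ?mul0r //=.
by rewrite (component_mul _ _ (D_deg a l)) leqNgt ei.
Qed.

Lemma component_row_deg i j v : row_deg j v ->
  map_mx (component i) v = if j == Posz i then v else 0.
Proof.
case: j => [j vj|j ->]; last first.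
  by rewrite /=; apply/rowP => l; rewrite !mxE raddf0.
apply/rowP => l; rewrite mxE (component_homog _ (vj l)) eqz_nat.
by case: eqP => //; rewrite mxE.
Qed.

Lemma coker_is_graded : graded (coker D).
Proof.
exists coker_gr; split.
- by move=> j; exists 0; [exact: row_deg0|rewrite raddf0].
- move=> j _ _ [v vj ->] [w wj ->]; exists (v - w); last by rewrite raddfB.
  case: j vj wj => [j vj wj l|j -> ->]; last by rewrite /= subrr.
  by rewrite !mxE; apply: veronese_degB.
- move=> i j b _ bi [v vj ->]; exists (b *: v); last by rewrite linearZ.
  case: j vj => [j vj|j ->]; last by rewrite scaler0; exact: row_deg0.
  by rewrite -PoszD => l; rewrite mxE; apply: veronese_degM.
- move=> z; have [v <-] := coker_pi_surj z.
  have /fin_all_exists[N0 vN] := fun l => component_sum (v 0 l).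
  pose N := (\max_l N0 l)%N; exists [seq Posz i | i <- index_iota 0 N].
  exists (fun j => if j is Posz i then coker_pi D (map_mx (component i) v) else 0).
  split=> [[i|i]|].
  + by exists (map_mx (component i) v) => // l; rewrite mxE; exact: component_deg.
  + by exists 0 => //; rewrite raddf0.
  rewrite big_map -raddf_sum /=; congr (coker_pi D _); apply/rowP => l.
  rewrite summxE big_mkord (vN l N) ?leq_bigmax //.
  by apply: eq_bigr => i _; rewrite mxE.
move=> s c us cs.
have /boolp.choice[v vP] : forall j, exists v, row_deg j v /\ c j = coker_pi D v.
  by move=> j; have [v vj ->] := cs j; exists v.
rewrite (eq_bigr (fun j => coker_pi D (v j))); last by move=> j _; case: (vP j).
rewrite -raddf_sum /= => /coker_pi_eq0/rowspaceP sv j js.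
have [vj ->] := vP j; case: j js vj => [j js vj|j js ->]; last by rewrite raddf0.
apply/coker_pi_eq0/rowspaceP; have := map_component_rowspace j sv.
rewrite raddf_sum /= (bigD1_seq (Posz j)) //= (component_row_deg _ vj) eqxx.
rewrite big1 ?addr0 // => i ij; rewrite (component_row_deg j (proj1 (vP i))).
by rewrite (negPf ij).
Qed.

End GradedCokernel.

(** When all differentials vanish modulo B_+, the Betti numbers are the ranks. The
    common degree e of the generators of the submodule makes the cokernel
    graded. *)
Lemma betti_vector_minimal (k : fieldType) (d e : nat) (rk : nat -> nat)
    (dmx : forall i, 'M[veronese k d]_(rk i.+1, rk i)) : (0 < d)%N ->
  (forall i j, veronese_deg k d e (dmx 0 i j)) ->
  (forall i (v : 'rV_(rk i.+1)),
     v *m dmx i = 0 <-> exists w, v = w *m dmx i.+1) ->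
  (forall i, map_mx (@residue k d) (dmx i) = 0) ->
  betti_vectors k d (vec4 (rk 0%N)%:R (rk 1%N)%:R (rk 2%N)%:R (rk 3%N)%:R).
Proof.
move=> d0 deg ex min; exists (coker (dmx 0)), rk; split=> //.
- exact: coker_is_graded deg.
- exact: coker_fg.
exists (@FreeResolution _ (coker (dmx 0)) rk dmx (coker_pi (dmx 0))
  (@coker_pi_surj _ _ _ _) (@coker_pi_eq0 _ _ _ _) ex).
case=> [|i]; first by rewrite tor_dim0E min mxrank0 subn0.
by rewrite tor_dimSE !min !mxrank0 !subn0.
Qed.

(** * Hilbert-Burch resolutions over the coordinate ring *)

Section HilbertBurch.
(* Here s = x^c, t = y^c and d = c (r + 1). The hypothesis cover holds for c = 1 and
   for r = 0: every monomial of B divisible by t is a multiple of some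
   t s^(r-j) t^j. *)
Variables (k : fieldType) (c r : nat) (c_gt0 : (0 < c)%N).
Local Notation d := (c * r.+1)%N.
Local Notation B := (veronese k d).
Local Notation S := (mpoly 2 k).
Local Notation s := (mono k c 0).
Local Notation t := (mono k 0 c).

Hypothesis cover : forall a b, (d %| a + b)%N -> (c <= b)%N ->
  exists j : 'I_r.+1, (c * (r - j) <= a)%N /\ (c * j.+1 <= b)%N.

(** The generators s^(r-j) t^j of a module over B inside k[x, y]; for c = 1 it
    consists of the polynomials whose monomials have degree -1 modulo d, for r = 0
    it is B. *)
Definition gam (j : 'I_r.+1) : S := mono k (c * (r - j)) (c * j).

Fact st_proof (j : 'I_r.+1) (i : nat) : (i <= 1)%N ->
  mono k (c * (r - j + (1 - i))) (c * (j + i)) \in veronese_pred k d.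
Proof.
move=> i1; apply/veronese_predP => m; rewrite mcoeffX.
case: (_ =P m) => [<- _|]; last by rewrite eqxx.
rewrite mdeg_exps -mulnDr; suff -> : (r - j + (1 - i) + (j + i) = r.+1)%N by [].
have := ltn_ord j; lia.
Qed.

Definition sgam j : B := Veronese (@st_proof j 0 isT).
Definition tgam j : B := Veronese (@st_proof j 1 isT).

Lemma vval_sgam j : vval (sgam j) = s * gam j.
Proof. by rewrite /= monoM add0n addn0 mulnDr muln1 addnC. Qed.

Lemma vval_tgam j : vval (tgam j) = t * gam j.
Proof. by rewrite /= monoM add0n subnn addn0 addn1 mulnS. Qed.

(** The element of that module with coordinates h. *)
Definition comb (h : 'I_r.+1 -> B) : S := \sum_j vval (h j) * gam j.

Lemma residue_sgam j : residue (sgam j) = 0.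
Proof.
rewrite /residue /= -exps00 mcoeff_mono addn1 mulnS; case: c c_gt0 => // c' _.
Qed.

Lemma residue_tgam j : residue (tgam j) = 0.
Proof.
rewrite /residue /= -exps00 mcoeff_mono addn1 mulnS andbC; case: c c_gt0 => // c' _.
Qed.

(** The combination of the Hilbert-Burch relations t e_l - s e_(l+1), with
    coefficient comb (H l) for the l-th one. Such a coefficient need not be
    in B, but its products with s and t are. *)
Definition hb_row q (H : 'M[B]_(q, r.+1)) : 'rV[B]_q.+1 :=
  \row_i \sum_(l < q) \sum_j H l j *
    ((if i == l :> nat then tgam j else 0) - (if i == l.+1 :> nat then sgam j else 0)).

Fact hb_row_is_linear q : linear (@hb_row q).
Proof.
move=> a H K; apply/rowP => i; rewrite !mxE mulr_sumr -big_split /=.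
apply: eq_bigr => l _; rewrite mulr_sumr -big_split /=; apply: eq_bigr => j _.
by rewrite !mxE mulrDl mulrA.
Qed.

HB.instance Definition _ q :=
  GRing.isLinear.Build B _ _ _ (@hb_row q) (@hb_row_is_linear q).

Lemma residueMr0 (a b : B) : residue b = 0 -> residue (a * b) = 0.
Proof. by move=> b0; rewrite rmorphM /= b0 mulr0. Qed.

Lemma residue_hb_row q (H : 'M[B]_(q, r.+1)) i : residue (hb_row H 0 i) = 0.
Proof.
rewrite mxE raddf_sum big1 // => l _; rewrite /= raddf_sum big1 // => j _.
apply: residueMr0; rewrite rmorphB /=.
have -> : residue (if i == l :> nat then tgam j else 0) = 0.
  by case: ifP => _; rewrite ?residue_tgam ?rmorph0.
have -> : residue (if i == l.+1 :> nat then sgam j else 0) = 0.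
  by case: ifP => _; rewrite ?residue_sgam ?rmorph0.
exact: subrr.
Qed.

Lemma vval_hb_entry (h : B) (b1 b2 : bool) j :
  vval (h * ((if b1 then tgam j else 0) - (if b2 then sgam j else 0))) =
  ((if b1 then t else 0) - (if b2 then s else 0)) * (vval h * gam j).
Proof.
transitivity (vval h * (vval (if b1 then tgam j else 0) - vval (if b2 then sgam j else 0))).
  by [].
have v0 : vval (0 : B) = 0 by [].
by case: b1; case: b2; rewrite ?vval_sgam ?vval_tgam ?v0; ring.
Qed.

Lemma vval_hb_row q (H : 'M[B]_(q, r.+1)) i : vval (hb_row H 0 i) =
  \sum_(l < q) ((if i == l :> nat then t else 0) - (if i == l.+1 :> nat then s else 0))
    * comb (H l).
Proof.
rewrite mxE raddf_sum; apply: eq_bigr => l _; rewrite /= raddf_sum mulr_sumr.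
by apply: eq_bigr => j _; exact: vval_hb_entry.
Qed.

Lemma hb_row_entry q (H : 'M[B]_(q, r.+1)) (g : nat -> S) (i : 'I_q.+1) :
  (forall l : 'I_q, g l = comb (H l)) ->
  vval (hb_row H 0 i) =
    (if (i < q)%N then t * g i else 0) - (if (0 < i)%N then s * g i.-1 else 0).
Proof.
move=> gH; rewrite vval_hb_row.
rewrite (eq_bigr (fun l : 'I_q => (if i == l :> nat then t * g l else 0)
   - (if i == l.+1 :> nat then s * g l else 0))); last first.
  by move=> l _; rewrite -gH; do 2![case: ifP => _]; ring.
rewrite sumrB; congr (_ - _).
  case: ifP => iq; last first.
    by rewrite big1 // => l _; case: eqP => // il; move: iq; rewrite il ltn_ord.
  rewrite (bigD1 (Ordinal iq)) //= eqxx big1 ?addr0 // => l li.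
  by case: eqP => // il; case/eqP: li; apply: val_inj.
case: ifP => i0; last by rewrite big1 // => l _; move: i0; case: (i : nat).
have iq : (i.-1 < q)%N by have := ltn_ord i; lia.
rewrite (bigD1 (Ordinal iq)) //= prednK // eqxx big1 ?addr0 // => l li.
by case: eqP => // il; case/eqP: li; apply: val_inj; rewrite /= il.
Qed.

(** The powers of s and t are coprime, so t divides a; the quotient is again a
    combination of the generators, by the hypothesis cover. *)
Lemma divide_first n (a : B) (b : S) : s ^+ n * vval a + t * b = 0 ->
  exists h, vval a = t * comb h.
Proof.
move=> ab0.
have a_c m : mcoeff m (vval a) != 0 -> (c <= m ord_max)%N.
  move=> am; rewrite leqNgt; apply: contraNN am => mc; apply/eqP.
  have := congr1 (mcoeff (exps (c * n + m ord0) (0 * n + m ord_max))) ab0.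
  rewrite monoX mcoeffD mcoeff_monoM -multinom2_eta mcoeff0.
  by rewrite mcoeff_monoM_lt ?addr0 // exps_ord_max mul0n mc orbT.
rewrite [vval a]mpolyE big_seq.
apply: (big_ind (fun f => exists h, f = t * comb h)) => [|f g [h ->] [h' ->]|m ma].
- exists (fun=> 0); rewrite /comb big1 ?mulr0 // => j _.
  by rewrite raddf0 mul0r.
- exists (fun j => h j + h' j); rewrite -mulrDr -big_split /=; congr (_ * _).
  by apply: eq_bigr => j _; rewrite raddfD mulrDl.
have dm : (d %| m ord0 + m ord_max)%N.
  rewrite -mdeg_exps -multinom2_eta; by have /allP := valP a; apply.
rewrite mcoeff_msupp in ma; have [j [j0 j1]] := cover dm (a_c m ma).
have hp : mcoeff m (vval a) *: mono k (m ord0 - c * (r - j)) (m ord_max - c * j.+1)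
    \in veronese_pred k d.
  apply/veronese_predP => m'; rewrite mcoeffZ mcoeffX.
  case: (_ =P m') => [<- _|]; last by rewrite mulr0 eqxx.
  rewrite mdeg_exps; move: dm; rewrite -{1}(subnK j0) -{1}(subnK j1) addnACA.
  rewrite -mulnDr; have -> : (r - j + j.+1 = r.+1)%N by have := ltn_ord j; lia.
  by rewrite dvdn_addl.
exists (fun i => if i == j then Veronese hp else 0).
rewrite /comb (bigD1 j) //= eqxx big1 ?addr0; last first.
  by move=> i ij; rewrite (negPf ij) mul0r.
rewrite -!scalerAl -scalerAr mpolyX_mono !monoM; congr (_ *: mono _ _ _); lia.
Qed.

(** Induction on q: the coefficient of s^q is divisible by t, hence can be
    cleared by the first Hilbert-Burch relation, after which a factor t
    cancels. *)
Lemma hb_nat q (f : nat -> B) :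
  \sum_(i < q.+1) vval (f i) * (s ^+ (q - i) * t ^+ i) = 0 ->
  exists H : nat -> 'I_r.+1 -> B, forall i, (i <= q)%N -> vval (f i) =
    (if (i < q)%N then t * comb (H i) else 0) -
    (if (0 < i)%N then s * comb (H i.-1) else 0).
Proof.
elim: q f => [|q IH] f.
  rewrite big_ord1 !expr0 !mulr1 => f0; exists (fun _ _ => 0) => i.
  by rewrite leqn0 => /eqP ->; rewrite f0 subr0.
rewrite big_ord_recl /= subn0 expr0 mulr1.
rewrite (eq_bigr (fun i : 'I_q.+1 =>
    t * (vval (f i.+1) * (s ^+ (q - i) * t ^+ i)))); last first.
  by move=> i _; rewrite /bump /= add1n subSS exprS; ring.
rewrite -mulr_sumr [vval (f 0%N) * _]mulrC => f0; have [h hP] := divide_first f0.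
pose f' i := f i.+1 + (if i == 0%N then \sum_j h j * sgam j else 0).
have hs : vval (\sum_j h j * sgam j) = s * comb h.
  rewrite raddf_sum mulr_sumr; apply: eq_bigr => j _.
  by transitivity (vval (h j) * vval (sgam j)) => //; rewrite vval_sgam; ring.
have f'0 : vval (f' 0%N) = vval (f 1%N) + s * comb h by rewrite /f' eqxx raddfD /= hs.
have f'S i : vval (f' i.+1) = vval (f i.+2) by rewrite /f' addr0.
clearbody f'; have [|H HP] := IH f'.
  apply: (mulfI (mono_neq0 k 0 c)); rewrite mulr0 -[RHS]f0 hP.
  rewrite !big_ord_recl /= f'0 subn0 expr0.
  under eq_bigr => i _ do rewrite /bump add1n f'S.
  rewrite exprS; set X := bigop _ _ _; move: X => X; ring.
exists (fun i => if i is i'.+1 then H i' else h) => -[|i] iq.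
  by rewrite hP subr0.
have -> : vval (f i.+1) = vval (f' i) - (if i == 0%N then s * comb h else 0).
  by case: i {iq} => [|i]; rewrite ?f'0 ?f'S ?addrK ?subr0.
rewrite HP // ltnS /=; case: i {iq} => [|i] /=; by rewrite ?subr0.
Qed.

Lemma hb_exact q (f : 'rV[B]_q.+1) :
  \sum_i vval (f 0 i) * (s ^+ (q - i) * t ^+ i) = 0 <-> exists H, f = hb_row H.
Proof.
split=> [f0|[H ->]].
  have [|H HP] := @hb_nat q (fun i => f 0 (inord i)).
    by rewrite -[RHS]f0; apply: eq_bigr => i _; rewrite inord_val.
  exists (\matrix_(l, j) H l j); apply/rowP => i; apply: val_inj => /=.
  have -> : f 0 i = f 0 (inord i) by rewrite inord_val.
  rewrite HP; last by rewrite -ltnS.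
  rewrite (@hb_row_entry q _ (fun l => comb (H l))) // => l.
  by apply: eq_bigr => j _; rewrite mxE.
rewrite (eq_bigr (fun i : 'I_q.+1 => \sum_(l < q)
    ((if i == l :> nat then t * (s ^+ (q - i) * t ^+ i) * comb (H l) else 0)
     - (if i == l.+1 :> nat then s * (s ^+ (q - i) * t ^+ i) * comb (H l) else 0)))).
  rewrite exchange_big big1 //= => l _; rewrite sumrB.
  have lq : (l < q.+1)%N by rewrite ltnS ltnW.
  have lq1 : (l.+1 < q.+1)%N by rewrite ltnS.
  rewrite (bigD1 (Ordinal lq)) //= eqxx big1 ?addr0 => [|i il]; last first.
    by case: eqP => // il'; case/eqP: il; apply: val_inj.
  rewrite (bigD1 (Ordinal lq1)) //= eqxx big1 ?addr0 => [|i il]; last first.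
    by case: eqP => // il'; case/eqP: il; apply: val_inj.
  have -> : (q - l = (q - l.+1).+1)%N by have := ltn_ord l; lia.
  by rewrite !exprS; ring.
move=> i _; rewrite vval_hb_row mulr_suml; apply: eq_bigr => l _.
by do 2![case: ifP => _]; ring.
Qed.

(** The Hilbert-Burch matrix is injective: its entries t on the diagonal
    determine the coefficients one after the other. *)
Lemma hb_row_eq0 q (H : 'M[B]_(q, r.+1)) :
  hb_row H = 0 <-> forall l, comb (H l) = 0.
Proof.
split=> [H0|H0]; last first.
  apply/rowP => i; apply: val_inj; rewrite /= vval_hb_row mxE /= big1 // => l _.
  by rewrite H0 mulr0.
pose g i := if insub i is Some l then comb (H l) else 0.
have gH (l : 'I_q) : g l = comb (H l) by rewrite /g valK.
suff g0 i : (i < q)%N -> g i = 0 by move=> l; rewrite -gH g0.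
elim: i => [|i IH] iq.
  have := hb_row_entry (Ordinal (ltnW iq : 0 < q.+1)%N) gH.
  rewrite H0 mxE /= iq subr0 => /esym/eqP; rewrite mulf_eq0.
  by rewrite (negPf (mono_neq0 _ _ _)) => /eqP.
have := hb_row_entry (Ordinal (ltnW iq : i.+1 < q.+1)%N) gH.
rewrite H0 mxE /= iq IH ?(ltnW iq) // mulr0 subr0 => /esym/eqP; rewrite mulf_eq0.
by rewrite (negPf (mono_neq0 _ _ _)) => /eqP.
Qed.

(** The r + 1 generators s^(r-j) t^j are themselves the maximal minors of a
    Hilbert-Burch matrix, the one with q = r. So a matrix all of whose rows are
    relations between them is given by r coefficients for each row. *)
Definition hb_blocks N (K : 'M[B]_(N * r, r.+1)) : 'M[B]_(N, r.+1) :=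
  \matrix_l hb_row (\matrix_(i < r) row (mxvec_index l i) K).

Fact hb_blocks_is_linear N : linear (@hb_blocks N).
Proof.
move=> a K L; apply/row_matrixP => l; rewrite !linearP /= !rowK -linearP.
by congr hb_row; apply/row_matrixP => i; rewrite !linearP /= !rowK linearP.
Qed.

HB.instance Definition _ N :=
  GRing.isLinear.Build B _ _ _ (@hb_blocks N) (@hb_blocks_is_linear N).

Lemma hb_blocks_eq0 N (K : 'M[B]_(N * r, r.+1)) :
  hb_blocks K = 0 <-> forall a, comb (K a) = 0.
Proof.
have combE l i : comb ((\matrix_(i < r) row (mxvec_index l i) K) i) =
    comb (K (mxvec_index l i)).
  by apply: eq_bigr => j _; rewrite !mxE.
split=> [K0 a|K0].
  case/mxvec_indexP: a => l i; have /(congr1 (row l)) := K0.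
  by rewrite rowK row0 => /hb_row_eq0/(_ i); rewrite combE.
apply/row_matrixP => l; rewrite rowK row0; apply/hb_row_eq0 => i.
by rewrite combE.
Qed.

Lemma hb_blocks_exact N (H : 'M[B]_(N, r.+1)) :
  (forall l, comb (H l) = 0) <-> exists K, H = hb_blocks K.
Proof.
have combE (G : 'M[B]_(N, r.+1)) l : comb (G l) =
    \sum_i vval (row l G 0 i) * (s ^+ (r - i) * t ^+ i).
  by apply: eq_bigr => j _; rewrite mxE !monoX monoM !mul0n addn0.
split=> [H0|[K ->] l].
  have /fin_all_exists[K KP] : forall l, exists K, row l H = hb_row K.
    by move=> l; apply/hb_exact; rewrite -combE.
  exists (\matrix_(a, j) mxvec (\matrix_(l, i) K l i j) 0 a).
  apply/row_matrixP => l; rewrite KP rowK; congr hb_row; apply/matrixP => i j.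
  by rewrite !mxE mxvecE mxE.
by rewrite combE; apply/hb_exact; rewrite rowK; eexists.
Qed.

Variable m : nat.

(** The module covered by the free module of index i + 2 consists of this many
    copies of the one generated by the s^(r-j) t^j. *)
Definition hb_count (i : nat) : nat := iter i (muln^~ r) m.

Definition hb_rk (i : nat) : nat :=
  match i with 0 => 1 | 1 => m.+1 | i.+2 => hb_count i * r.+1 end.

Hypothesis dm : (d %| c * m)%N.

Fact gen_proof (i : 'I_m.+1) :
  mono k d 0 * (s ^+ (m - i) * t ^+ i) \in veronese_pred k d.
Proof.
rewrite !monoX !monoM; apply/veronese_predP => n; rewrite mcoeffX.
case: (_ =P n) => [<- _|]; last by rewrite eqxx.
rewrite mdeg_exps !mul0n !addn0 !add0n -addnA -mulnDr subnK ?dvdn_add //.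
by rewrite -ltnS.
Qed.

Definition hb_gen : 'M[B]_(m.+1, 1) := \matrix_(i, j) Veronese (gen_proof i).

Definition hb_dmx (i : nat) : 'M[B]_(hb_rk i.+1, hb_rk i) :=
  match i with
  | 0 => hb_gen
  | 1 => lin1_mx (@hb_row m \o vec_mx)
  | i.+2 => lin_mx (@hb_blocks (hb_count i))
  end.

Lemma hb_gen_eq0 (v : 'rV[B]_m.+1) : v *m hb_gen = 0 <->
  \sum_i vval (v 0 i) * (s ^+ (m - i) * t ^+ i) = 0.
Proof.
have vE : vval ((v *m hb_gen) 0 0) =
    mono k d 0 * \sum_i vval (v 0 i) * (s ^+ (m - i) * t ^+ i).
  rewrite mxE raddf_sum mulr_sumr; apply: eq_bigr => i _.
  transitivity (vval (v 0 i) * vval (hb_gen i 0)) => //.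
  by rewrite mxE /=; ring.
split=> v0.
  apply: (mulfI (mono_neq0 k d 0)); rewrite -vE v0 mxE mulr0.
  by [].
apply/rowP => j; rewrite ord1; apply: val_inj; rewrite /= vE v0 mulr0 mxE.
by [].
Qed.

Lemma hb_dmx_exact i (v : 'rV_(hb_rk i.+1)) :
  v *m hb_dmx i = 0 <-> exists w, v = w *m hb_dmx i.+1.
Proof.
case: i v => [|[|i]] v.
- rewrite (rwP eqP) -(rwP eqP) /= hb_gen_eq0 hb_exact; split=> [[H ->]|[w ->]].
    by exists (mxvec H); rewrite mul_rV_lin1 /= mxvecK.
  by exists (vec_mx w); rewrite mul_rV_lin1.
- rewrite /= mul_rV_lin1 /= hb_row_eq0 hb_blocks_exact; split=> [[K vK]|[w ->]].
    by exists (mxvec K); rewrite mul_vec_lin /= -vK vec_mxK.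
  by exists (vec_mx w); rewrite mul_rV_lin mxvecK.
rewrite /= mul_rV_lin; transitivity (hb_blocks (vec_mx v) = 0).
  split=> [/eqP|v0]; first by rewrite mxvec_eq0 => /eqP.
  by apply/eqP; rewrite mxvec_eq0; apply/eqP.
rewrite hb_blocks_eq0 hb_blocks_exact; split=> [[K vK]|[w ->]].
  by exists (mxvec K); rewrite mul_vec_lin /= -vK vec_mxK.
by exists (vec_mx w); rewrite mul_rV_lin mxvecK.
Qed.

Lemma hb_gen_deg : exists e, forall i j, veronese_deg k d e (hb_gen i j).
Proof.
have /dvdnP[q qE] := dm; exists q.+1 => i j.
rewrite /veronese_deg mxE /= !monoX !monoM dhomogX /= mdeg_exps.
rewrite !mul0n !addn0 !add0n -addnA -mulnDr subnK -1?ltnS //.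
by rewrite qE mulSn.
Qed.

Lemma hb_dmx_minimal i : map_mx (@residue k d) (hb_dmx i) = 0.
Proof.
have d_gt0 : (0 < d)%N by rewrite muln_gt0 c_gt0.
case: i => [|[|i]]; apply/matrixP => a b; rewrite [LHS]mxE [RHS]mxE.
- rewrite mxE /residue /= !monoX !monoM -exps00 mcoeff_mono.
  by rewrite addn_eq0 (gtn_eqF d_gt0).
- by rewrite mxE; exact: residue_hb_row.
case/mxvec_indexP: b => l j; rewrite mxE /= mxvecE mxE.
exact: residue_hb_row.
Qed.

Lemma hb_betti_vector :
  betti_vectors k d (vec4 1 m.+1%:R (m * r.+1)%:R (m * r * r.+1)%:R).
Proof.
have [e eP] := hb_gen_deg.
apply: (@betti_vector_minimal k d e hb_rk hb_dmx) => //.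
- by rewrite muln_gt0 c_gt0.
- exact: hb_dmx_exact.
- exact: hb_dmx_minimal.
Qed.

End HilbertBurch.

(** * Cones in rational four-space *)

Section Cones.
Local Open Scope classical_set_scope.

Definition coor (v : Q4) (i : nat) : rat := v 0 (inord i).

Lemma coor_vec4 a b c e i : (i < 4)%N -> coor (vec4 a b c e) i = [:: a; b; c; e]`_i.
Proof. by move=> i4; rewrite /coor mxE inordK. Qed.

Lemma coorD v w i : coor (v + w) i = coor v i + coor w i.
Proof. by rewrite /coor mxE. Qed.

Lemma coorZ (t : rat) v i : coor (t *: v) i = t * coor v i.
Proof. by rewrite /coor mxE. Qed.

Lemma coor0 i : coor 0 i = 0.
Proof. by rewrite /coor mxE. Qed.

Lemma coor_inj v w : (forall i, (i < 4)%N -> coor v i = coor w i) -> v = w.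
Proof.
move=> vw; apply/rowP => i; have := vw i (ltn_ord i).
by rewrite /coor inord_val.
Qed.

Lemma vec4_eta v : v = vec4 (coor v 0) (coor v 1) (coor v 2) (coor v 3).
Proof. by apply: coor_inj => -[|[|[|[|//]]]] i4; rewrite coor_vec4. Qed.

Lemma vec4_eqP a b c e a' b' c' e' : a = a' -> b = b' -> c = c' -> e = e' ->
  vec4 a b c e = vec4 a' b' c' e'.
Proof. by move=> -> -> -> ->. Qed.

Lemma vec4D a b c e a' b' c' e' :
  vec4 a b c e + vec4 a' b' c' e' = vec4 (a + a') (b + b') (c + c') (e + e').
Proof.
by apply: coor_inj => -[|[|[|[|//]]]] i4; rewrite coorD !coor_vec4.
Qed.

Lemma vec4Z (t a b c e : rat) : t *: vec4 a b c e = vec4 (t * a) (t * b) (t * c) (t * e).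
Proof.
by apply: coor_inj => -[|[|[|[|//]]]] i4; rewrite coorZ !coor_vec4.
Qed.

Definition halfspaces n (A : 'M[rat]_(4, n)) : set Q4 :=
  [set v | forall j, 0 <= (v *m A) 0 j].

Lemma halfspaces_convex n (A : 'M[rat]_(4, n)) : convex_cone (halfspaces A).
Proof.
split=> [j|s t x y s0 t0 xA yA j]; first by rewrite mul0mx mxE.
rewrite mulmxDl -!scalemxAl !mxE addr_ge0 // mulr_ge0 //;
  by [have := xA j; rewrite mxE|have := yA j; rewrite mxE].
Qed.

Lemma cone_sub_convex (X C : set Q4) : convex_cone C -> X `<=` C -> cone X `<=` C.
Proof.
move=> [C0 CD] XC _ [n [c [x [c0 xX ->]]]].
have CDD u w : C u -> C w -> C (u + w).
  by move=> Cu Cw; rewrite -[u]scale1r -[w]scale1r; apply: CD.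
apply: big_ind => //= i _; rewrite -[_ *: _]addr0 -[X in _ + X](scale0r 0).
by apply: CD => //; exact: XC.
Qed.

(** A linear form that is negative at v is negative on a small ball around v; its
    radius is bounded through the sum of the absolute values of the
    coefficients. *)
Lemma halfspaces_closure n (A : 'M[rat]_(4, n)) (X : set Q4) :
  X `<=` halfspaces A -> closure X `<=` halfspaces A.
Proof.
move=> XA v vX j; rewrite leNgt; apply/negP => vA.
pose N : rat := 1 + \sum_i `|A i j|.
have N0 : 0 < N by rewrite ltr_wpDr // sumr_ge0.
pose eps : rat := - (v *m A) 0 j / N.
have eps0 : 0 < eps by rewrite divr_gt0 // oppr_gt0.
have [w [/XA/(_ j) wA [_ vw]]] := vX _ (nbhsx_ballx v eps eps0).
have {}vw i : `|v 0 i - w 0 i| < eps by have := vw 0 i.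
have : (w *m A) 0 j - (v *m A) 0 j <= eps * (\sum_i `|A i j|).
  rewrite !mxE -sumrB mulr_sumr; apply: ler_sum => i _.
  rewrite -mulrBl (le_trans (ler_norm _)) // normrM ler_wpM2r //.
  by rewrite distrC ltW.
have epsN : eps * N = - (v *m A) 0 j by rewrite mulfVK // gt_eqF.
move: epsN; rewrite /N mulrDr mulr1; move: wA vA eps0; clear.
move: (\sum_i _) ((w *m A) 0 j) ((v *m A) 0 j) => x y z; move: eps => q; lra.
Qed.

Lemma closure_direction (X : set Q4) (v u : Q4) :
  (forall eps : rat, 0 < eps -> exists2 t, 0 <= t < eps & X (v + t *: u)) ->
  closure X v.
Proof.
move=> vX B /nbhs_ballP[eps eps0 vB].
pose N : rat := 1 + \sum_i `|u 0 i|.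
have N0 : 0 < N by rewrite ltr_wpDr // sumr_ge0.
have [t /andP[t0 te] Xt] := vX (eps / N) (divr_gt0 eps0 N0).
exists (v + t *: u); split=> //; apply: vB; split=> // a i; rewrite ord1.
suff : `|v 0 i - (v + t *: u) 0 i| < eps by [].
rewrite !mxE opprD addNKr normrN normrM (ger0_norm t0).
rewrite ltr_pdivlMr // in te; apply: le_lt_trans te.
rewrite ler_wpM2l // (le_trans (y := \sum_i `|u 0 i|)) ?lerDr //.
by rewrite (bigD1 i) //= lerDl sumr_ge0.
Qed.

Lemma cone4 (X : set Q4) (a b c e : rat) (x y z w : Q4) :
  0 <= a -> 0 <= b -> 0 <= c -> 0 <= e -> X x -> X y -> X z -> X w ->
  cone X (a *: x + b *: y + c *: z + e *: w).
Proof.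
move=> a0 b0 c0 e0 Xx Xy Xz Xw.
exists 4, (fun i => nth 0 [:: a; b; c; e] i), (fun i => nth 0 [:: x; y; z; w] i).
split; [by case=> [[|[|[|[|//]]]]]|by case=> [[|[|[|[|//]]]]]|].
by rewrite !big_ord_recl big_ord0 /= addr0 !addrA.
Qed.

End Cones.

Section Polyhedron.
Local Open Scope classical_set_scope.
Variables (d : nat) (d_gt0 : (0 < d)%N).

Let dR : 0 < d%:R :> rat. Proof. by rewrite ltr0n. Qed.
Let d1 : 1 <= d%:R :> rat. Proof. by rewrite ler1n. Qed.

(** The inequalities with cleared denominators, in a form that covers d = 1: there
    the second and third one say 0 <= b2 and b3 <= 0. *)
Definition poly_ineqs (b0 b1 b2 b3 : rat) : Prop :=
  [/\ 0 <= b3, 0 <= b2, b3 <= (d%:R - 1) * b2, d%:R * b2 <= d%:R * b1 + b3 &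
      d%:R * b1 + b3 <= d%:R * (b0 + b2)].

Lemma second_ineqE (b2 b3 : rat) : 0 <= b3 ->
  second_ineq d b2 b3 <-> 0 <= b2 /\ b3 <= (d%:R - 1) * b2.
Proof.
move=> b30; rewrite /second_ineq; case: eqP => [->|/eqP dn1].
  rewrite subrr mul0r; split=> -[h1 h2]; split=> //; first by rewrite h1.
  by apply/eqP; rewrite eq_le h2 b30.
have d2 : 0 < d%:R - 1 :> rat by rewrite subr_gt0 ltr1n; lia.
rewrite subr_ge0 ler_pdivrMr // mulrC; split=> [h|[]//]; split=> //.
by have := le_trans b30 h; rewrite pmulr_rge0.
Qed.

Lemma betti_polyhedronE v : betti_polyhedron d v <->
  poly_ineqs (coor v 0) (coor v 1) (coor v 2) (coor v 3).
Proof.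
have i3 (b1 b2 b3 : rat) : (0 <= b1 - b2 + b3 / d%:R) = (d%:R * b2 <= d%:R * b1 + b3 :> rat).
  rewrite -(pmulr_rge0 _ dR) mulrDr mulrBr mulrCA divff ?gt_eqF // mulr1.
  by rewrite -[RHS]subr_ge0 addrAC.
have i4 (b0 b1 b2 b3 : rat) : (0 <= b0 - b1 + b2 - b3 / d%:R) =
    (d%:R * b1 + b3 <= d%:R * (b0 + b2) :> rat).
  rewrite -(pmulr_rge0 _ dR) -[RHS]subr_ge0; congr (_ <= _).
  by field; rewrite gt_eqF.
split=> [[b0 [b1 [b2 [b3 [-> [h0 /(second_ineqE _ h0)[h1 h2] h3 h4]]]]]]|[h0 h1 h2 h3 h4]].
  rewrite !coor_vec4 //=; split=> //; first by rewrite -i3.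
  by rewrite -i4.
exists (coor v 0), (coor v 1), (coor v 2), (coor v 3); split; first exact: vec4_eta.
by split=> //; [apply/second_ineqE|rewrite i3|rewrite i4].
Qed.

Definition poly_mx : 'M[rat]_(4, 5) := \matrix_(i, j)
  (nth [::] [:: [:: 0; 0; 0; 1]; [:: 0; 0; 1; 0]; [:: 0; 0; d%:R - 1; -1];
    [:: 0; d%:R; - d%:R; 1]; [:: d%:R; - d%:R; d%:R; -1]] j)`_i.

Lemma betti_polyhedron_halfspaces : betti_polyhedron d = halfspaces poly_mx.
Proof.
have vA v j : (v *m poly_mx) 0 j = coor v 0 * poly_mx (inord 0) j +
    coor v 1 * poly_mx (inord 1) j + coor v 2 * poly_mx (inord 2) j +
    coor v 3 * poly_mx (inord 3) j.
  rewrite mxE !big_ord_recl big_ord0 addr0 !addrA /coor.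
  by do ![congr (_ + _)]; congr (v 0 _ * poly_mx _ j); apply: val_inj; rewrite /= inordK.
apply/seteqP; split=> v.
  move=> /betti_polyhedronE[h0 h1 h2 h3 h4] j; rewrite vA !mxE !inordK //.
  case: j => [[|[|[|[|[|//]]]]] /= _]; lra.
move=> vh; apply/betti_polyhedronE; have {}vh j (hj : (j < 5)%N) := vh (Ordinal hj).
move: (vh 0%N isT) (vh 1%N isT) (vh 2%N isT) (vh 3%N isT) (vh 4%N isT).
rewrite !vA !mxE !inordK //=; split; lra.
Qed.

Local Notation e1 := (vec4 1 0 0 0).
Local Notation e2 := (vec4 1 1 0 0).
Local Notation e3 := (vec4 0 1 1 0).
Local Notation e4 := (vec4 0 1 d%:R (d%:R * (d%:R - 1))).

(** The coefficients are the four linear forms that define the polyhedron, up to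
    positive factors. For d = 1 the last two generators coincide and the last
    coefficient is taken to be zero. *)
Lemma poly_generators v : betti_polyhedron d v -> exists a b c e : rat,
  [/\ 0 <= a, 0 <= b, 0 <= c, 0 <= e & v = a *: e1 + b *: e2 + c *: e3 + e *: e4].
Proof.
move=> /betti_polyhedronE[h0 h1 h2 h3 h4]; rewrite [v]vec4_eta.
move: (coor v 0) (coor v 1) (coor v 2) (coor v 3) h0 h1 h2 h3 h4.
move=> b0 b1 b2 b3 h0 h1 h2 h3 h4.
have dn0 : d%:R != 0 :> rat by rewrite gt_eqF.
pose q : rat := b3 / d%:R; have b3q : b3 = d%:R * q by rewrite mulrCA divff ?mulr1.
have q0 : 0 <= q by rewrite divr_ge0 // ltW.
have h3' : 0 <= b1 - b2 + q.
  by rewrite -(pmulr_rge0 _ dR); move: h3; rewrite b3q; lra.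
have h4' : 0 <= b0 - b1 + b2 - q.
  by rewrite -(pmulr_rge0 _ dR); move: h4; rewrite b3q; lra.
exists (b0 - b1 + b2 - q), (b1 - b2 + q).
have [dE|dn1] := eqVneq d 1%N.
  exists b2, 0; split=> //; rewrite !vec4Z !vec4D.
  have b30 : b3 = 0 by apply/eqP; rewrite eq_le h0 andbT; move: h2; rewrite dE subrr mul0r.
  have q00 : q = 0 by rewrite /q b30 mul0r.
  by apply: vec4_eqP; rewrite ?q00 ?b30; ring.
have d2 : 0 < d%:R - 1 :> rat by rewrite subr_gt0 ltr1n; lia.
exists (b2 - d%:R * (q / (d%:R - 1))), (q / (d%:R - 1)); split=> //.
- by rewrite subr_ge0 mulrA -b3q ler_pdivrMr // mulrC.
- by rewrite divr_ge0 // ltW.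
rewrite !vec4Z !vec4D b3q; have d2n0 : d%:R - 1 != 0 :> rat by rewrite gt_eqF.
by apply: vec4_eqP; field.
Qed.

Lemma poly_e1 : betti_polyhedron d e1.
Proof. have h := d1; apply/betti_polyhedronE; rewrite !coor_vec4 //=; split; lra. Qed.
Lemma poly_e2 : betti_polyhedron d e2.
Proof. have h := d1; apply/betti_polyhedronE; rewrite !coor_vec4 //=; split; lra. Qed.
Lemma poly_e3 : betti_polyhedron d e3.
Proof. have h := d1; apply/betti_polyhedronE; rewrite !coor_vec4 //=; split; lra. Qed.
Lemma poly_e4 : betti_polyhedron d e4.
Proof.
have x0 := dR; have x1 := d1; apply/betti_polyhedronE; rewrite !coor_vec4 //=.
have p : 0 <= d%:R * (d%:R - 1) :> rat by rewrite mulr_ge0 ?subr_ge0 // ltW.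
by split; lra.
Qed.

Lemma ray_poly v : betti_polyhedron d v -> ray v `<=` betti_polyhedron d.
Proof.
rewrite betti_polyhedron_halfspaces => vP _ [t t0 ->].
have [_ CD] := halfspaces_convex poly_mx.
by rewrite -[t *: v]addr0 -(scale0r v); apply: CD.
Qed.

Lemma extremal_ray_intro v : v != 0 -> betti_polyhedron d v ->
  (forall x y t, betti_polyhedron d x -> betti_polyhedron d y -> x + y = t *: v ->
    ray v x) ->
  extremal_ray (betti_polyhedron d) (ray v).
Proof.
move=> v0 vP vx; split; [by exists v|exact: ray_poly|].
move=> x y xP yP [t _ xy]; split; first exact: vx xP yP xy.
by apply: vx yP xP _; rewrite addrC; exact: xy.
Qed.

Lemma vec4_neq0 (a b c e : rat) : (a != 0) || (b != 0) -> vec4 a b c e != 0.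
Proof.
apply: contraTneq => v0.
have := coor_vec4 a b c e (isT : (0 < 4)%N).
have := coor_vec4 a b c e (isT : (1 < 4)%N).
by rewrite v0 !coor0 /= => <- <-; rewrite eqxx.
Qed.

(** A nonzero element of an extremal ray is a nonnegative combination of the four
    generators, and a generator with positive coefficient must span the ray.
    Conversely, the inequalities that are equalities at a generator are
    equalities at all summands of its multiples, and they cut out its ray. *)
Lemma poly_extremal R : extremal_ray (betti_polyhedron d) R <->
  [\/ R = ray e1, R = ray e2, R = ray e3 | R = ray e4].
Proof.
have dn0 : d%:R != 0 :> rat by rewrite gt_eqF.
split=> [[[v v0 ->] RP Rx]|].
  have vR : ray v v by exists 1; rewrite ?scale1r.
  have [a [b [c [e [a0 b0 c0 e0 vE]]]]] := poly_generators (RP _ vR).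
  have [_ CD] : convex_cone (betti_polyhedron d).
    by rewrite betti_polyhedron_halfspaces; exact: halfspaces_convex.
  have CDD u w : betti_polyhedron d u -> betti_polyhedron d w -> betti_polyhedron d (u + w).
    by move=> Cu Cw; rewrite -[u]scale1r -[w]scale1r; apply: CD.
  have CZ (t : rat) u : 0 <= t -> betti_polyhedron d u -> betti_polyhedron d (t *: u).
    by move=> t0 Cu; apply: (ray_poly Cu); exists t.
  have key (t : rat) u w : 0 <= t -> t != 0 -> u != 0 -> betti_polyhedron d u ->
      betti_polyhedron d w -> v = t *: u + w -> ray v = ray u.
    move=> t0 tn0 u0 uP wP vtu.
    have [[t' t'0 tu] _] : ray v (t *: u) /\ ray v w.
      by apply: Rx => //; [exact: CZ|rewrite -vtu].
    have t'n0 : t' != 0.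
      apply: contraNneq u0 => t'00; move/eqP: tu.
      by rewrite t'00 scale0r scaler_eq0 (negPf tn0).
    apply/seteqP; split=> _ [q q0 ->].
      exists (q / t' * t); first by rewrite mulr_ge0 ?divr_ge0.
      by rewrite -[in RHS]scalerA tu scalerA divfK.
    exists (q / t * t'); first by rewrite mulr_ge0 ?divr_ge0.
    by rewrite -[in RHS]scalerA -tu scalerA divfK.
  have P1 := poly_e1; have P2 := poly_e2; have P3 := poly_e3; have P4 := poly_e4.
  have n1 : e1 != 0 by rewrite vec4_neq0 ?oner_eq0.
  have n2 : e2 != 0 by rewrite vec4_neq0 ?oner_eq0.
  have n3 : e3 != 0 by rewrite vec4_neq0 ?oner_eq0 ?orbT.
  have n4 : e4 != 0 by rewrite vec4_neq0 ?oner_eq0 ?orbT.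
  have [a00|an0] := eqVneq a 0; last first.
    apply: Or41; apply: (key a e1 (b *: e2 + c *: e3 + e *: e4)) => //; last first.
      by rewrite vE !addrA.
    by apply: (CDD); [apply: (CDD)|]; apply: (CZ).
  have [b00|bn0] := eqVneq b 0; last first.
    apply: Or42; apply: (key b e2 (c *: e3 + e *: e4)) => //; last first.
      by rewrite vE a00 scale0r add0r !addrA.
    by apply: (CDD); apply: (CZ).
  have [c00|cn0] := eqVneq c 0; last first.
    apply: Or43; apply: (key c e3 (e *: e4)) => //; last first.
      by rewrite vE a00 b00 !scale0r !add0r.
    exact: CZ.
  have en0 : e != 0.
    apply: contraNneq v0 => e00.
    by rewrite vE a00 b00 c00 e00 !scale0r !addr0.
  apply: Or44; apply: (key e e4 0) => //.
    by rewrite betti_polyhedron_halfspaces; case: (halfspaces_convex poly_mx).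
  by rewrite vE a00 b00 c00 !scale0r !add0r addr0.
have split_ray x y t v i : x + y = t *: v ->
    [/\ coor x i + coor y i = t * coor v i &
        d%:R * coor x i + d%:R * coor y i = d%:R * (t * coor v i)].
  by move=> xy; rewrite -mulrDr -coorD xy coorZ.
case=> ->; apply: extremal_ray_intro; rewrite ?vec4_neq0 ?oner_eq0 ?orbT //;
  [exact: poly_e1| |exact: poly_e2| |exact: poly_e3| |exact: poly_e4|];
  move=> x y t /betti_polyhedronE[x0 x1 x2 x3 x4] /betti_polyhedronE[y0 y1 y2 y3 y4] xy;
  have [] := split_ray _ _ _ _ 0%N xy; have [] := split_ray _ _ _ _ 1%N xy;
  have [] := split_ray _ _ _ _ 2 xy; have [] := split_ray _ _ _ _ 3 xy;
  rewrite !coor_vec4 //= => s3 ds3 s2 ds2 s1 ds1 s0 ds0;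
  rewrite [x]vec4_eta.
- have x30 : coor x 3 = 0 by lra.
  have x20 : coor x 2 = 0 by lra.
  have x10 : coor x 1 = 0 by apply: (mulfI dn0); move: x3 y3; rewrite x20; lra.
  rewrite x30 x20 x10; exists (coor x 0); last first.
    by rewrite vec4Z; apply: vec4_eqP; rewrite ?mulr0 ?mulr1.
  by rewrite -(pmulr_rge0 _ dR); move: x4; rewrite x30 x20 x10; lra.
- have x30 : coor x 3 = 0 by lra.
  have x20 : coor x 2 = 0 by lra.
  have x10 : coor x 0 = coor x 1 by apply: (mulfI dn0); move: x4 y4; lra.
  rewrite x30 x20 x10; exists (coor x 1); last first.
    by rewrite vec4Z; apply: vec4_eqP; rewrite ?mulr0 ?mulr1.
  by rewrite -(pmulr_rge0 _ dR); move: x3; rewrite x30 x20; lra.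
- have x30 : coor x 3 = 0 by lra.
  have x12 : coor x 1 = coor x 2 by apply: (mulfI dn0); lra.
  have x00 : coor x 0 = 0 by apply: (mulfI dn0); lra.
  rewrite x30 x12 x00; exists (coor x 2) => //.
  by rewrite vec4Z; apply: vec4_eqP; rewrite ?mulr0 ?mulr1.
have x32 : coor x 3 = (d%:R - 1) * coor x 2 by lra.
have x21 : coor x 2 = d%:R * coor x 1 by lra.
have x00 : coor x 0 = 0 by apply: (mulfI dn0); lra.
rewrite x32 x21 x00; exists (coor x 1); last first.
  by rewrite vec4Z; apply: vec4_eqP; ring.
by rewrite -(pmulr_rge0 _ dR) -x21.
Qed.

End Polyhedron.

(** * The cone of total Betti numbers *)

Section BettiCone.
Local Open Scope classical_set_scope.
Variables (k : fieldType) (d : nat) (d_gt0 : (0 < d)%N).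

Lemma betti_vectors_poly : betti_vectors k d `<=` betti_polyhedron d.
Proof.
case: d d_gt0 => // p _ _ [M [b [_ _ [F bF] ->]]].
apply/betti_polyhedronE => //; rewrite !coor_vec4 //= !bF.
have [h1 h2 h3] := veronese_tor_ineqs F; split; rewrite ?ler0n //.
- by rewrite -natr1 addrK -natrM ler_nat.
- by rewrite -!natrM -natrD ler_nat.
- by rewrite -natrD -!natrM -natrD ler_nat.
Qed.

Lemma betti_free : betti_vectors k d (vec4 1 0 0 0).
Proof.
pose rk i : nat := if i is 0 then 1%N else 0%N.
apply: (@betti_vector_minimal k d 0 rk (fun i => 0)) => // [[]//|i v|i].
  by split=> _; [exists 0; rewrite mulmx0; apply/rowP => -[]|rewrite mulmx0].
exact: map_mx0.
Qed.

(** The case s = x^d, t = y^d. *)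
Lemma betti_e3 m : betti_vectors k d (vec4 1 m.+1%:R m%:R 0).
Proof.
have := @hb_betti_vector k d 0 d_gt0 _ m _.
rewrite muln1 !muln0 mul0n muln1; apply; last by rewrite dvdn_mulr.
by move=> a b _ db; exists ord0; rewrite muln0 muln1.
Qed.

(** The case s = x, t = y. *)
Lemma betti_e4 q : betti_vectors k d
  (vec4 1 (q * d).+1%:R (q * d * d)%:R (q * d * d.-1 * d)%:R).
Proof.
case: d d_gt0 => // p _; have := @hb_betti_vector k 1 p isT _ (q * p.+1)%N _.
rewrite mul1n; apply; last by rewrite mul1n dvdn_mull.
move=> a b dab b1; have [db|bd] := leqP p.+1 b.
  by exists ord_max; rewrite subnn muln0 mul1n.
have h : (b.-1 < p.+1)%N by lia.
exists (Ordinal h); rewrite !mul1n /= prednK //; split=> //.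
have : (p.+1 <= a + b)%N by apply: dvdn_leq => //; lia.
lia.
Qed.

(** Using betti_e3 n and betti_e4 n instead of the last two generators changes a
    combination by a multiple of (1, 1, 0, 0) that tends to zero as n grows. *)
Lemma betti_polyhedron_sub_closure :
  betti_polyhedron d `<=` closure (betti_cone k d).
Proof.
move=> v /(poly_generators d_gt0)[a [b [c [e [a0 b0 c0 e0 ->]]]]].
have dR : 0 < d%:R :> rat by rewrite ltr0n.
apply: (@closure_direction _ _ (vec4 1 1 0 0)) => eps eps0.
pose T := c + e / d%:R; have T0 : 0 <= T by rewrite addr_ge0 // divr_ge0 // ltW.
have [n nR Tn] : exists2 n, 0 < n%:R :> rat & T / eps < n%:R.
  have Te : 0 <= T / eps by rewrite divr_ge0 // ltW.
  exists (Num.bound (T / eps)).+1; rewrite ?ltr0n //.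
  by apply: lt_trans (archi_boundP Te) _; rewrite ltr_nat.
exists (T / n%:R).
  by rewrite divr_ge0 ?(ltW nR) //= ltr_pdivrMr // mulrC -ltr_pdivrMr.
have -> : a *: vec4 1 0 0 0 + b *: vec4 1 1 0 0 + c *: vec4 0 1 1 0 +
    e *: vec4 0 1 d%:R (d%:R * (d%:R - 1)) + (T / n%:R) *: vec4 1 1 0 0 =
  a *: vec4 1 0 0 0 + b *: vec4 1 1 0 0 + (c / n%:R) *: vec4 1 n.+1%:R n%:R 0 +
  (e / (n * d)%:R) *: vec4 1 (n * d).+1%:R (n * d * d)%:R (n * d * d.-1 * d)%:R.
  have dp : d.-1%:R = d%:R - 1 :> rat by rewrite -subn1 natrB.
  rewrite -[n.+1]addn1 -[(n * d).+1]addn1 !natrD !natrM dp !vec4Z !vec4D /T.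
  by apply: vec4_eqP; field; rewrite ?gt_eqF.
apply: cone4; rewrite ?divr_ge0 ?ler0n //.
- exact: betti_free.
- exact: (betti_e3 0).
- exact: betti_e3.
- exact: betti_e4.
Qed.

(** First coordinates are nonnegative, so all modules that occur have b_0 = 0. *)
Lemma cone_coor0 v : betti_cone k d v -> coor v 0 = 0 -> v = 0.
Proof.
move=> [n [c [x [c0 xB ->]]]] v0.
have cx0 i : 0 <= c i * coor (x i) 0.
  have [M [b [_ _ _ ->]]] := xB i.
  by rewrite coor_vec4 // mulr_ge0 ?ler0n.
have vE : coor (\sum_i c i *: x i) 0 = \sum_i c i * coor (x i) 0.
  elim/big_rec2: _ => [|i y1 y2 _ IH]; first exact: coor0.
  by rewrite coorD coorZ IH.
have /eqP := v0; rewrite vE psumr_eq0 // => /allP all0.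
apply: big1 => i _; have := all0 i (mem_index_enum i).
rewrite mulf_eq0 => /orP[/eqP -> |]; first exact: scale0r.
have [M [b [gM fM tM xE]]] := xB i.
rewrite xE coor_vec4 //= pnatr_eq0 => /eqP b0.
rewrite !(total_betti_zero d_gt0 gM fM tM b0).
by rewrite [X in _ *: X](_ : _ = 0) ?scaler0 //; apply: coor_inj => -[|[|[|[|//]]]] i4;
  rewrite coor_vec4 // coor0.
Qed.

End BettiCone.

Local Open Scope classical_set_scope.

Theorem mainTheorem3 (k : fieldType) (d : nat) (hd : (1 <= d)%N) :
  let e1 := vec4 1 0 0 0 in
  let e2 := vec4 1 1 0 0 in
  let e3 := vec4 0 1 1 0 in
  let e4 := vec4 0 1 d%:R (d%:R * (d%:R - 1)) in
  [/\ closure (betti_cone k d) = betti_polyhedron d,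
      convex_cone (betti_polyhedron d) /\ polyhedral (betti_polyhedron d),
      forall R : set Q4, extremal_ray (betti_polyhedron d) R <->
        [\/ R = ray e1, R = ray e2, R = ray e3 | R = ray e4],
      ray e3 `&` betti_cone k d `<=` [set 0] &
      ray e4 `&` betti_cone k d `<=` [set 0]].
Proof.
move=> e1 e2 e3 e4; have PE := betti_polyhedron_halfspaces hd; split.
- apply/seteqP; split; last exact: betti_polyhedron_sub_closure.
  rewrite PE; apply: halfspaces_closure; apply: cone_sub_convex.
    exact: halfspaces_convex.
  by rewrite -PE; exact: betti_vectors_poly.
- rewrite PE; split; first exact: halfspaces_convex.
  by exists 5, (poly_mx d).
- exact: poly_extremal.
- move=> _ [[t _ ->] tC]; apply: (cone_coor0 hd tC).
  by rewrite coorZ coor_vec4 //= mulr0.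
- move=> _ [[t _ ->] tC]; apply: (cone_coor0 hd tC).
  by rewrite coorZ coor_vec4 //= mulr0.
Qed.
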